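(* There exist exactly $19$ unimodular equivalence classes of $7$-dimensional Gorenstein simplices in $\mathbb{R}^7$ of degree $4$ which are not lattice pyramids.
   Context: A lattice polytope is a convex polytope in $\mathbb{R}^d$ all of whose vertices lie in $\mathbb{Z}^d$. Two lattice polytopes $P,Q\subset\mathbb{R}^d$ are unimodularly equivalent if $Q=f_U(P)+\mathbf{w}$ for some $\mathbf{w}\in\mathbb{Z}^d$ and some $U\in\mathbb{Z}^{d\times d}$ with $\det U=\pm1$, where $f_U(\mathbf{x})=\mathbf{x}U$. For a lattice polytope $P\subset\mathbb{R}^{d}$ of dimension $d$, $\mathrm{Pyr}(P)=\mathrm{conv}(P\times\{0\},(0,\dots,0,1))\subset\mathbb{R}^{d+1}$; a lattice polytope is a lattice pyramid if, up to unimodular equivalence, it is obtained by successively applying $\mathrm{Pyr}$ (at least once) to a lower-dimensional lattice polytope. For a $d$-dimensional lattice polytope $P\subset\mathbb{R}^d$, $\mathrm{codeg}(P)=\min\{n\in\mathbb{Z}_{>0}:\mathrm{int}(nP)\cap\mathbb{Z}^d\ne\emptyset\}$ and the degree is $\deg(P)=d+1-\mathrm{codeg}(P)$. A $d$-dimensional lattice polytope $P\subset\mathbb{R}^d$ is reflexive if the origin is in its interior and $P^\vee=\{\mathbf{y}\in\mathbb{R}^d:\langle\mathbf{x},\mathbf{y}\rangle\le1\ \forall\mathbf{x}\in P\}$ is a lattice polytope; $P$ is Gorenstein if $rP$ is unimodularly equivalent to a reflexive polytope for some integer $r\ge1$. A Gorenstein simplex is a lattice simplex that is Gorenstein. *)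

(* Defs.v *)
From HB Require Import structures.
From mathcomp Require Import all_boot all_order all_algebra.
From mathcomp Require Import all_classical all_reals all_analysis.

Set Implicit Arguments.
Unset Strict Implicit.
Unset Printing Implicit Defensive.

Import Order.TTheory GRing.Theory Num.Theory.
Import numFieldNormedType.Exports.

Local Open Scope classical_set_scope.
Local Open Scope ring_scope.

(* Points of R^d are row vectors, so that f_U(x) = x U is [x *m U]. *)

Definition lattice (R : realType) (d : nat) : set 'rV[R]_d :=
  range (map_mx intr : 'rV[int]_d -> 'rV[R]_d).

Definition conv_hull (R : realType) (d : nat) (S : set 'rV[R]_d) :
    set 'rV[R]_d :=
  [set x | exists (n : nat) (v : 'I_n -> 'rV[R]_d) (c : 'I_n -> R),
     [/\ forall i, S (v i), forall i, 0 <= c i, \sum_i c i = 1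
       & x = \sum_i c i *: v i]].

Definition aff_hull (R : realType) (d : nat) (S : set 'rV[R]_d) :
    set 'rV[R]_d :=
  [set x | exists (n : nat) (v : 'I_n -> 'rV[R]_d) (c : 'I_n -> R),
     [/\ forall i, S (v i), \sum_i c i = 1 & x = \sum_i c i *: v i]].

(* The affine hull of S is a translate of a k-dimensional linear subspace;
   in particular S is nonempty. *)
Definition has_dim (R : realType) (d : nat) (S : set 'rV[R]_d) (k : nat) :
    Prop :=
  exists (p : 'rV[R]_d) (U : {vspace 'rV[R]_d}),
    \dim U = k /\ aff_hull S = [set p + u | u in [set u | u \in U]].

Definition polytope (R : realType) (d : nat) (P : set 'rV[R]_d) : Prop :=
  exists2 S : set 'rV[R]_d, finite_set S & P = conv_hull S.

(* The vertices of a polytope are its extreme points. *)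
Definition vertex (R : realType) (d : nat) (P : set 'rV[R]_d) (v : 'rV[R]_d) :
    Prop :=
  P v /\ forall (x y : 'rV[R]_d) (t : R),
    P x -> P y -> 0 < t < 1 -> v = t *: x + (1 - t) *: y -> x = v /\ y = v.

Definition lattice_polytope (R : realType) (d : nat) (P : set 'rV[R]_d) :
    Prop :=
  polytope P /\ forall v, vertex P v -> lattice v.

Definition affinely_independent (R : realType) (d n : nat)
    (v : 'I_n -> 'rV[R]_d) : Prop :=
  forall c : 'I_n -> R,
    \sum_i c i = 0 -> \sum_i c i *: v i = 0 -> forall i, c i = 0.

Definition simplex (R : realType) (d : nat) (P : set 'rV[R]_d) : Prop :=
  exists (k : nat) (v : 'I_k.+1 -> 'rV[R]_d),
    affinely_independent v /\ P = conv_hull (range v).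

Definition unimod_equiv (R : realType) (d : nat) (P Q : set 'rV[R]_d) : Prop :=
  exists (U : 'M[int]_d) (w : 'rV[int]_d),
    (\det U = 1 \/ \det U = -1) /\
    Q = [set x *m map_mx intr U + map_mx intr w | x in P].

Definition unimod_class (R : realType) (d : nat) (P : set 'rV[R]_d) :
    set (set 'rV[R]_d) :=
  [set Q | unimod_equiv P Q].

Definition dilate (R : realType) (d : nat) (n : nat) (P : set 'rV[R]_d) :
    set 'rV[R]_d :=
  [set n%:R *: x | x in P].

(* The point (y, t) of R^d x R. *)
Definition append (R : realType) (d : nat) (y : 'rV[R]_d) (t : R) :
    'rV[R]_d.+1 :=
  \row_(i < d.+1) if unlift ord_max i is Some j then y 0 j else t.

Definition Pyr (R : realType) (d : nat) (P : set 'rV[R]_d) :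
    set 'rV[R]_d.+1 :=
  conv_hull ([set append y 0 | y in P] `|` [set append 0 1]).

Inductive iterated_Pyr (R : realType) (d0 : nat) (P0 : set 'rV[R]_d0) :
    forall d : nat, set 'rV[R]_d -> Prop :=
| iterated_Pyr_one : iterated_Pyr P0 (Pyr P0)
| iterated_Pyr_next (d : nat) (P : set 'rV[R]_d) :
    iterated_Pyr P0 P -> iterated_Pyr P0 (Pyr P).

Definition lattice_pyramid (R : realType) (d : nat) (P : set 'rV[R]_d) : Prop :=
  exists (d0 : nat) (P0 : set 'rV[R]_d0) (Q : set 'rV[R]_d),
    [/\ lattice_polytope P0, has_dim P0 d0, iterated_Pyr P0 Q
      & unimod_equiv P Q].

(* For a full-dimensional P the set below has a (unique) least element, so the
   default value 0 is never used. *)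
Definition codeg (R : realType) (d : nat) (P : set 'rV[R]_d) : nat :=
  let A := [set n : nat | (0 < n)%N /\ (dilate n P)° `&` @lattice R d !=set0] in
  xget 0%N [set n | A n /\ forall m, A m -> (n <= m)%N].

Definition degree (R : realType) (d : nat) (P : set 'rV[R]_d) : int :=
  d%:Z + 1 - (codeg P)%:Z.

Definition polar_dual (R : realType) (d : nat) (P : set 'rV[R]_d) : set 'rV[R]_d :=
  [set y | forall x, P x -> \sum_i x 0 i * y 0 i <= 1].

Definition reflexive_polytope (R : realType) (d : nat) (P : set 'rV[R]_d) :
    Prop :=
  [/\ lattice_polytope P, has_dim P d, P° 0 & lattice_polytope (polar_dual P)].

Definition gorenstein (R : realType) (d : nat) (P : set 'rV[R]_d) : Prop :=
  [/\ lattice_polytope P, has_dim P d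
    & exists r : nat, (1 <= r)%N /\
        exists Q : set 'rV[R]_d,
          unimod_equiv (dilate r P) Q /\ reflexive_polytope Q].

Definition gorenstein_simplex (R : realType) (d : nat) (P : set 'rV[R]_d) :
    Prop :=
  simplex P /\ gorenstein P.

(* Main.v *)
Require Import Defs.
From HB Require Import structures.
From mathcomp Require Import all_boot all_order all_algebra.
From mathcomp Require Import all_classical all_reals all_analysis.
From mathcomp Require Import fingroup perm.
From mathcomp Require Import ring lra zify.

(** Let P be a lattice simplex of dimension d with vertices v_0, ..., v_d, and
    write a point x at height h in barycentric coordinates:
    (h, x) = sum_i t_i (1, v_i).

    If P is Gorenstein of codegree r, then each t_i takes its values on
    Z^(d+1) in (1/b_i) Z for some positive integer b_i, and the unique interior
    lattice point of rP has coordinates t_i = 1/b_i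
    ([gorenstein_unit_fractions]); in particular sum_i 1/b_i = r. If b_i = 1,
    the i-th vertex is at lattice distance one from the opposite facet and P is
    a lattice pyramid ([pyramid_of_facet]). So if P is not a pyramid, all b_i
    are at least 2 and r <= (d+1)/2. For d = 7 and degree 4 the codegree is
    4 = (d+1)/2, which forces every b_i to be 2 ([gorenstein_half_integral]).
    Conversely, simplices with half-integral coordinates for which
    (1/2, ..., 1/2) is a lattice point are Gorenstein of codegree (d+1)/2
    ([half_integral_gorenstein]) and are not pyramids ([pyramid_odd_sum]).

    For such simplices Z^8 is generated by the (1, v_i) and by the points whose
    coordinates t are the halves of the words of a binary code of length 8, the
    left kernel modulo 2 of the matrix with rows (1, v_i). The words of this
    code have even weight, and the all-ones word is one of them. Two such
    simplices are unimodularly equivalent if and only if their codes agree up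
    to a permutation of the coordinates ([unimod_equiv_code],
    [code_unimod_equiv]).

    It remains to count the even binary codes of length 8 that contain the
    all-ones word, up to permutation. Every such code is reached from the
    repetition code by adding one word at a time. A finite verification shows
    that the 19 codes of [codes] are closed, up to permutation, under adding an
    even word ([codes_extend]), so that they represent all orbits
    ([code_classification]); a permutation invariant tells them apart
    ([codes_inv_uniq]). Each of them is the code of an explicit simplex
    ([code_vertices]). *)

Set Implicit Arguments.
Unset Strict Implicit.
Unset Printing Implicit Defensive.


(** * Even binary codes of length eight *)

Definition addw (x y : bitseq) : bitseq := [seq b.1 (+) b.2 | b <- zip x y].
Definition zerow : bitseq := nseq 8 false.
Definition weight (c : bitseq) : nat := count id c.
(** The generators of a code will be in systematic form, with coordinates
    1, ..., k as information positions. Hence a word c of the code is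
    recovered from its tail [behead c], of which [mask] only reads the first
    k bits. *)
Definition comb (G : seq bitseq) (m : bitseq) : bitseq :=
  foldr addw zerow (mask m G).
(** The representative of the coset of c that vanishes on the information
    positions. *)
Definition residue (G : seq bitseq) (c : bitseq) : bitseq :=
  addw c (comb G (behead c)).
Definition in_code (G : seq bitseq) (c : bitseq) : bool := residue G c == zerow.
Definition act (p : seq nat) (c : bitseq) : bitseq := [seq nth false c i | i <- p].

Fixpoint words (n : nat) : seq bitseq :=
  if n is n'.+1 then
    [seq false :: c | c <- words n'] ++ [seq true :: c | c <- words n']
  else [:: [::]].

(** Generators of one code in each orbit, each generator given by its support.
    The i-th generator, counted from 0, is the only one that contains i + 1
    among the information positions. Coordinate 0 is never one of them. *)
Definition code_supports : seq (seq (seq nat)) := [::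
  [:: [:: 0; 1; 2; 3; 4; 5; 6; 7]];
  [:: [:: 0; 1; 3; 7]; [:: 2; 4; 5; 6]];
  [:: [:: 0; 1; 4; 5; 6; 7]; [:: 2; 3]];
  [:: [:: 0; 1; 5; 6]; [:: 0; 2; 5; 7]; [:: 0; 3; 4; 5]];
  [:: [:: 1; 5; 6; 7]; [:: 2; 5]; [:: 0; 3; 4; 5]];
  [:: [:: 1; 4]; [:: 2; 7]; [:: 0; 3; 5; 6]];
  [:: [:: 1; 4]; [:: 0; 2; 4; 5; 6; 7]; [:: 3; 4]];
  [:: [:: 1; 5; 6; 7]; [:: 0; 2; 6; 7]; [:: 0; 3; 5; 7]; [:: 0; 4; 5; 6]];
  [:: [:: 0; 1; 5; 6]; [:: 2; 6]; [:: 0; 3; 6; 7]; [:: 0; 4]];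
  [:: [:: 1; 5]; [:: 0; 2]; [:: 3; 7]; [:: 4; 6]];
  [:: [:: 1; 5]; [:: 2; 5]; [:: 0; 3; 5; 7]; [:: 4; 6]];
  [:: [:: 1; 6]; [:: 2; 6]; [:: 3; 6]; [:: 0; 4; 5; 7]];
  [:: [:: 0; 1]; [:: 2; 6]; [:: 3; 7]; [:: 0; 4; 6; 7]; [:: 0; 5; 6; 7]];
  [:: [:: 0; 1; 6; 7]; [:: 0; 2]; [:: 0; 3]; [:: 4; 6]; [:: 5; 6]];
  [:: [:: 1; 6]; [:: 2; 7]; [:: 0; 3]; [:: 4; 6]; [:: 5; 6]];
  [:: [:: 1; 7]; [:: 0; 2; 6; 7]; [:: 3; 7]; [:: 4; 7]; [:: 5; 7]];
  [:: [:: 1; 7]; [:: 2; 7]; [:: 0; 3]; [:: 0; 4]; [:: 0; 5]; [:: 6; 7]];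
  [:: [:: 1; 7]; [:: 2; 7]; [:: 3; 7]; [:: 0; 4]; [:: 5; 7]; [:: 6; 7]];
  [:: [:: 0; 1]; [:: 0; 2]; [:: 0; 3]; [:: 0; 4]; [:: 0; 5]; [:: 0; 6]; [:: 0; 7]]].

(** Coordinate permutations, listed by their values. Whenever an even word is
    added to one of the codes above, the larger code is the image of another
    code above under one of these permutations. *)
Definition moves : seq (seq nat) := [::
  [:: 0; 1; 3; 2; 5; 4; 6; 7]; [:: 0; 1; 3; 5; 2; 4; 7; 6]; [:: 0; 3; 4; 1; 5; 6; 7; 2];
  [:: 0; 4; 5; 2; 6; 7; 3; 1]; [:: 0; 5; 1; 4; 6; 2; 7; 3]; [:: 0; 5; 4; 3; 2; 1; 7; 6];
  [:: 0; 6; 2; 3; 7; 1; 4; 5]; [:: 1; 0; 2; 5; 4; 6; 3; 7]; [:: 1; 2; 0; 7; 6; 5; 3; 4];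
  [:: 1; 7; 6; 0; 5; 2; 4; 3]; [:: 2; 0; 1; 4; 5; 7; 6; 3]; [:: 2; 3; 1; 4; 6; 0; 7; 5];
  [:: 2; 5; 4; 0; 1; 7; 3; 6]; [:: 2; 6; 4; 1; 3; 5; 0; 7]; [:: 3; 0; 1; 4; 6; 7; 5; 2];
  [:: 3; 1; 0; 7; 6; 4; 5; 2]; [:: 3; 1; 5; 2; 0; 6; 4; 7]; [:: 3; 1; 5; 4; 0; 7; 6; 2];
  [:: 3; 1; 6; 0; 2; 7; 5; 4]; [:: 3; 1; 6; 5; 2; 0; 4; 7]; [:: 3; 2; 1; 0; 7; 5; 4; 6];
  [:: 3; 4; 2; 7; 0; 5; 1; 6]; [:: 3; 4; 5; 0; 6; 7; 2; 1]; [:: 3; 4; 6; 5; 7; 2; 1; 0];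
  [:: 3; 5; 2; 0; 7; 6; 1; 4]; [:: 3; 6; 1; 4; 2; 7; 0; 5]; [:: 3; 6; 5; 0; 4; 2; 7; 1];
  [:: 4; 0; 5; 2; 6; 1; 7; 3]; [:: 4; 0; 5; 7; 3; 2; 6; 1]; [:: 4; 1; 3; 2; 5; 0; 6; 7];
  [:: 4; 2; 3; 1; 5; 6; 0; 7]; [:: 4; 3; 2; 6; 1; 5; 7; 0]; [:: 4; 7; 2; 5; 1; 6; 0; 3];
  [:: 4; 7; 5; 2; 0; 3; 1; 6]; [:: 5; 1; 4; 3; 2; 6; 7; 0]; [:: 5; 2; 4; 3; 6; 7; 1; 0];
  [:: 5; 3; 2; 6; 4; 1; 7; 0]; [:: 5; 6; 0; 1; 4; 3; 2; 7]; [:: 5; 6; 2; 7; 4; 0; 3; 1];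
  [:: 5; 7; 4; 1; 2; 0; 6; 3]; [:: 6; 1; 4; 2; 5; 3; 0; 7]; [:: 6; 2; 0; 1; 5; 7; 3; 4];
  [:: 6; 2; 0; 7; 3; 4; 5; 1]; [:: 6; 3; 2; 5; 4; 1; 7; 0]; [:: 6; 5; 7; 2; 4; 0; 1; 3];
  [:: 6; 7; 4; 1; 3; 2; 0; 5]; [:: 6; 7; 4; 1; 5; 0; 3; 2]; [:: 7; 0; 2; 5; 6; 3; 4; 1];
  [:: 7; 2; 3; 1; 5; 0; 4; 6]; [:: 7; 2; 4; 1; 5; 3; 0; 6]; [:: 7; 5; 4; 1; 2; 6; 3; 0];
  [:: 7; 6; 2; 5; 1; 3; 4; 0]; [:: 7; 6; 4; 2; 3; 0; 5; 1]; [:: 7; 6; 5; 1; 3; 0; 4; 2];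
  [:: 7; 6; 5; 2; 0; 1; 3; 4]].

Definition codes : seq (seq bitseq) :=
  [seq [seq [seq i \in s | i <- iota 0 8] | s <- G] | G <- code_supports].

(** The code generated by G and w is equal, up to one of the permutations, to
    the code of G'. An inclusion suffices because the dimensions agree. *)
Definition extends_to (G : seq bitseq) (w : bitseq) (G' : seq bitseq) : bool :=
  (size G' == (size G).+1) && has (fun q : seq nat =>
    all (fun g => in_code G (act q g) || in_code G (addw w (act q g))) G') moves.

(** The number of words, the number of words of weight 2, and the number of
    ordered pairs of those that overlap in one position. The weight enumerator does not
    suffice: two of the codes of dimension 4 have the same one. *)
Definition code_inv (C : bitseq -> bool) : nat * nat * nat :=
  let L := [seq c <- words 8 | C c] in
  let L2 := [seq c <- L | weight c == 2] in
  (size L, size L2,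
   sumn [seq count (fun y => weight (addw x y) == 2) L2 | x <- L2]).

(** It is enough to add residues, since a word and its residue generate the
    same code over G. *)
Lemma codes_extend : all (fun G => all (fun w => has (extends_to G w) codes)
    [seq w <- undup [seq residue G c | c <- words 8] | ~~ odd (weight w) & w != zerow])
  codes.
Proof.
(* Call by need matters: the search for a permutation and the test of each
   candidate stop as soon as they are decided. *)
by lazy.
Qed.

Lemma codes_inv_uniq : uniq [seq code_inv (in_code G) | G <- codes].
Proof. by lazy. Qed.

Lemma codes_wf : all (fun G => [&& (size G <= 7)%N, in_code G (nseq 8 true) &
  all (fun g => (size g == 8) && ~~ odd (weight g)) G]) codes.
Proof. by lazy. Qed.

Lemma moves_wf : all (fun q => perm_eq q (iota 0 8)) moves.
Proof. by lazy. Qed.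

(** In systematic form the square matrix of the generators, without its
    coordinate 0 and completed by zero rows, is [[I, A], [0, 0]], hence
    idempotent. *)
Lemma codes_idem : all (fun G =>
   all (fun i => all (fun j =>
     count (fun l => nth false (nth [::] G i) l.+1 && nth false (nth [::] G l) j.+1)
       (iota 0 7) == nth false (nth [::] G i) j.+1) (iota 0 7)) (iota 0 7)) codes.
Proof. by lazy. Qed.

Lemma mem_words n c : (c \in words n) = (size c == n).
Proof.
elim: n c => [|n IHn] [|b c] //=.
  by rewrite mem_cat; apply/norP; split; apply/mapP => -[].
rewrite mem_cat eqSS -IHn; have inj a : injective (cons a : bitseq -> _).
  by move=> x y [].
case: b; rewrite (mem_map (inj _)).
  by rewrite (_ : (true :: c \in _) = false) //; apply/mapP => -[].
by rewrite orbC (_ : (false :: c \in _) = false) //; apply/mapP => -[].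
Qed.

Lemma words_uniq n : uniq (words n).
Proof.
elim: n => //= n IHn; have inj a : injective (cons a : bitseq -> _).
  by move=> x y [].
rewrite cat_uniq !(map_inj_uniq (inj _)) IHn /= andbT.
by apply/hasPn => _ /mapP[c _ ->]; apply/mapP => -[].
Qed.

Lemma size_addw x y : size x = 8 -> size y = 8 -> size (addw x y) = 8.
Proof. by move=> sx sy; rewrite size_map size_zip sx sy. Qed.

Lemma nth_addw x y i : size x = size y ->
  nth false (addw x y) i = nth false x i (+) nth false y i.
Proof.
elim: x y i => [|a x IHx] [|b y] // i; first by rewrite nth_nil.
by case: i => // i [/IHx]; apply.
Qed.

Lemma addw0 x : size x = 8 -> addw x zerow = x.
Proof.
rewrite /zerow => <-; elim: x => //= b x IHx.
by rewrite /addw /= addbF; congr cons; exact: IHx.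
Qed.

Lemma addww x : size x = 8 -> addw x x = zerow.
Proof.
rewrite /zerow => <-; elim: x => //= b x IHx.
by rewrite /addw /= addbb; congr cons; exact: IHx.
Qed.

Lemma addwC x y : addw x y = addw y x.
Proof.
elim: x y => [|a x IHx] [|b y] //; rewrite /addw /= addbC; congr cons.
exact: IHx.
Qed.

Lemma addwA x y z : addw x (addw y z) = addw (addw x y) z.
Proof.
elim: x y z => [|a x IHx] [|b y] [|c z] //; rewrite /addw /= addbA; congr cons.
exact: IHx.
Qed.

Lemma addwK x y : size x = 8 -> size y = 8 -> addw x (addw x y) = y.
Proof. by move=> sx sy; rewrite addwA addww // addwC addw0. Qed.

Lemma addw_eq0 x y : size x = 8 -> size y = 8 -> addw x y = zerow -> x = y.
Proof.
move=> sx sy xy; rewrite -(addwK sy sx) addwC -[in RHS](addw0 sy).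
by rewrite (addwC y x) xy addwC.
Qed.

Section Act.
Variable p : seq nat.
Hypothesis pP : perm_eq p (iota 0 8).

Lemma size_act c : size (act p c) = 8.
Proof. by rewrite size_map (perm_size pP). Qed.

Lemma act_addw x y : size x = size y -> act p (addw x y) = addw (act p x) (act p y).
Proof.
move=> sxy; apply: (@eq_from_nth _ false) => [|i].
  by rewrite size_addw ?size_act.
rewrite size_act => i8; rewrite nth_addw ?size_act //.
by rewrite !(nth_map 0) ?(perm_size pP) // nth_addw.
Qed.

Lemma act_comp q c : perm_eq q (iota 0 8) ->
  act p (act q c) = act [seq nth 0 q i | i <- p] c.
Proof.
move=> qP; rewrite /act -map_comp; apply/eq_in_map => i /=.
by rewrite (perm_mem pP) mem_iota => i8; rewrite (nth_map 0) // (perm_size qP).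
Qed.

Lemma perm_comp q : perm_eq q (iota 0 8) ->
  perm_eq [seq nth 0 q i | i <- p] (iota 0 8).
Proof.
move=> qP; apply: perm_trans (perm_map _ pP) _.
have sq : size q = 8 by rewrite (perm_size qP).
by rewrite -{1}sq -/(mkseq _ _) mkseq_nth.
Qed.

Lemma act_inj x y : size x = 8 -> size y = 8 -> act p x = act p y -> x = y.
Proof.
move=> sx sy xy; apply: (@eq_from_nth _ false) => [|i]; first by rewrite sx.
rewrite sx => i8; have ip : i \in p by rewrite (perm_mem pP) mem_iota.
by move/eq_in_map: xy => /(_ i ip).
Qed.

Lemma weight_act c : size c = 8 -> weight (act p c) = weight c.
Proof.
move=> sc; have cE : act (iota 0 8) c = c by rewrite -sc; exact: mkseq_nth.
rewrite /weight; have /seq.permP -> // : perm_eq (act p c) c.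
by rewrite -[in X in perm_eq _ X]cE; exact: perm_map.
Qed.

Lemma perm_words : perm_eq [seq act p c | c <- words 8] (words 8).
Proof.
have u : uniq [seq act p c | c <- words 8].
  rewrite map_inj_in_uniq ?words_uniq // => x y.
  by rewrite !mem_words => /eqP sx /eqP sy; apply: act_inj.
apply: (uniq_perm u (words_uniq 8)).
have [] := uniq_min_size u (s2 := words 8) => //.
  by move=> _ /mapP[c _ ->]; rewrite mem_words size_act.
Qed.

(** A permutation of the coordinates permutes the list of all words and
    preserves weights and sums. *)
Lemma code_inv_act (C C' : bitseq -> bool) :
  (forall c, size c = 8 -> C' (act p c) = C c) -> code_inv C' = code_inv C.
Proof.
move=> CC'; rewrite /code_inv.
set L := [seq c <- words 8 | C c]; set L' := [seq c <- words 8 | C' c].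
have LL' : perm_eq L' (map (act p) L).
  rewrite perm_sym.
  apply: perm_trans (_ : perm_eq _ [seq c <- map (act p) (words 8) | C' c]) _.
    rewrite filter_map perm_map // (@eq_in_filter _ _ C) // => c.
    by rewrite mem_words => /eqP /CC'.
  exact: perm_filter perm_words.
set L2 := [seq c <- L | _]; set L2' := [seq c <- L' | _].
have sL c : c \in L -> size c = 8 by rewrite mem_filter mem_words => /andP[_ /eqP].
have sL2 c : c \in L2 -> size c = 8 by rewrite mem_filter => /andP[_ /sL].
have LL2' : perm_eq L2' (map (act p) L2).
  apply: perm_trans (perm_filter _ LL') _.
  rewrite filter_map perm_map // (@eq_in_filter _ _ (fun c => weight c == 2)) //.
  move=> c /sL sc.
  by rewrite /= weight_act.
congr (_, _, _).
- by rewrite (perm_size LL') size_map.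
- by rewrite (perm_size LL2') size_map.
rewrite (perm_sumn (perm_map _ LL2')) -map_comp; congr sumn.
apply/eq_in_map => x /sL2 sx /=.
rewrite (seq.permP LL2') count_map; apply: eq_in_count => y /sL2 sy /=.
by rewrite -act_addw ?sx ?sy // weight_act // size_addw.
Qed.

End Act.

Section Comb.
Variable G : seq bitseq.
Hypothesis sG : forall g, g \in G -> size g = 8.

Lemma comb_ind (P : bitseq -> Prop) m : P zerow ->
  (forall x y, size x = 8 -> size y = 8 -> P x -> P y -> P (addw x y)) ->
  (forall g, g \in G -> P g) -> size (comb G m) = 8 /\ P (comb G m).
Proof.
move=> P0 PD PG; rewrite /comb.
have : {subset mask m G <= G} by move=> g; apply: mem_mask.
elim: (mask m G) => [|g s IHs] sub //=.
have gG : g \in G by apply: sub; rewrite mem_head.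
have [|s8 Ps] := IHs; first by move=> h hs; apply: sub; rewrite in_cons hs orbT.
have sg := sG gG; split; first exact: size_addw.
by apply: PD => //; exact: PG.
Qed.

Lemma size_comb m : size (comb G m) = 8.
Proof. by have [] := @comb_ind (fun=> True) m. Qed.

Lemma in_codeE c : size c = 8 -> in_code G c = (c == comb G (behead c)).
Proof.
move=> sc; apply/eqP/eqP => [|cE]; first by apply: addw_eq0; rewrite ?size_comb.
by rewrite /residue -cE addww.
Qed.

End Comb.

Definition even_code_with_ones (C : bitseq -> bool) : Prop :=
  [/\ C zerow, C (nseq 8 true),
      forall x y, size x = 8 -> size y = 8 -> C x -> C y -> C (addw x y)
    & forall x, size x = 8 -> C x -> ~~ odd (weight x)].

Lemma codes_size G g : G \in codes -> g \in G -> size g = 8.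
Proof.
move=> /(allP codes_wf)/and3P[_ _ /allP wf] /wf.
by case/andP => /eqP.
Qed.

(** Among the codes of the list that embed into C by a permutation, take one
    that cannot be enlarged. If its image misses a word of C, adding that word
    leads to a code of the next dimension that still embeds into C. *)
Lemma code_classification (C : bitseq -> bool) : even_code_with_ones C ->
  exists G p, [/\ G \in codes, perm_eq p (iota 0 8) &
    forall c, size c = 8 -> C (act p c) = in_code G c].
Proof.
case=> C0 C1 CD Ceven.
(* The permutation p embeds the code generated by G into C. *)
pose S (G : seq bitseq) p := [/\ G \in codes, perm_eq p (iota 0 8) &
  forall g, g \in G -> C (act p g)].
have SC G p m : S G p -> C (act p (comb G m)).
  case=> Gc pP CG.
  have [] // := @comb_ind G (fun g => @codes_size G g Gc) (fun x => C (act p x)) m.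
  - by rewrite (_ : act p zerow = zerow) // /act; apply: (@eq_from_nth _ false) =>
      [|i]; rewrite size_map (perm_size pP) // => i8;
      rewrite (nth_map 0) ?(perm_size pP) // !nth_nseq; case: ifP; case: ifP.
  - by move=> x y sx sy Cx Cy; rewrite act_addw ?sx ?sy //; apply: CD; rewrite ?size_act.
have step G p : S G p ->
    (forall c, size c = 8 -> C (act p c) -> in_code G c) \/
    exists G' p', S G' p' /\ size G' = (size G).+1.
  move=> SGp; have [Gc pP CG] := SGp; have sG g := @codes_size G g Gc.
  have [/hasP[c]|/hasPn max] :=
    boolP (has (fun c => C (act p c) && ~~ in_code G c) (words 8)); last first.
    left=> c sc Cc; have := max c; rewrite mem_words sc eqxx => /(_ isT).
    by rewrite Cc negbK.
  rewrite mem_words => /eqP sc /andP[Cc cG]; right.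
  (* As the code of G is sent into C, a word and its residue are sent into C
     together. *)
  pose w := residue G c; have scomb m := size_comb sG m.
  have sw : size w = 8 by rewrite size_addw.
  have Cw : C (act p w).
    by rewrite act_addw ?scomb ?sc //; apply: CD; rewrite ?size_act ?SC.
  have /(allP (allP codes_extend G Gc)) /hasP[G' G'c] :
      w \in [seq w <- undup [seq residue G c | c <- words 8] |
             ~~ odd (weight w) & w != zerow].
    rewrite mem_filter mem_undup cG -(weight_act pP sw) Ceven ?size_act //.
    by rewrite map_f // mem_words sc.
  case/andP => /eqP sG' /hasP[q qm /allP qG].
  have qP := allP moves_wf q qm.
  exists G', [seq nth 0 q i | i <- p]; split=> //.
  split=> [//||g gG']; first exact: perm_comp.
  rewrite -(act_comp pP) //; move: (act q g) (qG g gG') (size_act qP g) => x xG sx.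
  case/orP: xG => [|/eqP].
    by rewrite (in_codeE sG) // => /eqP ->; apply: SC.
  rewrite /residue => xE; rewrite -(addwK sw sx) act_addw ?size_addw ?sw //.
  apply: CD; rewrite ?size_act //.
  by rewrite (addw_eq0 _ _ xE) ?size_addw //; apply: SC.
have ext n G p : S G p -> 7 - size G <= n ->
    exists G p, S G p /\ forall c, size c = 8 -> C (act p c) -> in_code G c.
  elim: n G p => [|n IHn] G p SGp Gn; have [max|[G' [p' [S' sG']]]] := step _ _ SGp;
    try by exists G, p.
    have [G'c _ _] := S'; have /and3P[+ _ _] := allP codes_wf G' G'c.
    by rewrite sG' ltnNge -subn_eq0 -leqn0 Gn.
  by apply: IHn S' _; rewrite sG' subnS; case: (7 - _) Gn.
have S0 : S [:: nseq 8 true] (iota 0 8).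
  split=> //.
  by move=> g; rewrite inE => /eqP ->.
have [G [p [SGp max]]] := ext 7 _ _ S0 (leq_subr _ _).
have [Gc pP _] := SGp; exists G, p; split=> // c sc; apply/idP/idP; first exact: max.
by rewrite (in_codeE (fun g => @codes_size G g Gc)) // => /eqP ->; apply: SC.
Qed.

Import Order.TTheory GRing.Theory Num.Theory.
Import numFieldNormedType.Exports.

Local Open Scope classical_set_scope.
Local Open Scope ring_scope.

(** * Convex hulls of finitely many points *)

Section Hull.
Variable R : realType.

Definition hull (n d : nat) (V : 'M[R]_(n, d)) : set 'rV[R]_d :=
  [set x | exists c : 'rV[R]_n,
     [/\ forall i, 0 <= c 0 i, \sum_i c 0 i = 1 & x = c *m V]].

(** In a combination of points taken from the rows of V, the coefficients of
    equal rows can be added up. *)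
Lemma collect_row (n m : nat) (f : 'I_n -> 'I_m) (c : 'I_n -> R) d
    (V : 'M[R]_(m, d)) (c' := \row_j \sum_(i | f i == j) c i) :
  [/\ \sum_j c' 0 j = \sum_i c i & c' *m V = \sum_i c i *: row (f i) V].
Proof.
split.
  rewrite [RHS](partition_big f xpredT) //=.
  by apply: eq_bigr => j _; rewrite mxE.
rewrite mulmx_sum_row [RHS](partition_big f xpredT) //=.
apply: eq_bigr => j _; rewrite mxE scaler_suml.
by apply: eq_bigr => i /eqP <-.
Qed.

Lemma row_hull n d (V : 'M[R]_(n, d)) i : hull V (row i V).
Proof.
exists (delta_mx 0 i); split; last by rewrite rowE.
  by move=> j; rewrite mxE; case: (_ && _).
rewrite (bigD1 i) //= mxE !eqxx big1 ?addr0 // => j /negPf ji.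
by rewrite mxE ji andbF.
Qed.

Lemma conv_hull_rows n d (V : 'M[R]_(n, d)) :
  conv_hull (range (fun i => row i V)) = hull V.
Proof.
apply/seteqP; split=> x.
  case=> m [v [c [vV c0 c1 ->]]].
  have /choice[f fE] : forall i, exists j, v i = row j V.
    by move=> i; case: (vV i) => j _ <-; exists j.
  have [s1 s2] := collect_row f c V.
  exists (\row_j \sum_(i | f i == j) c i); split.
  - by move=> i; rewrite mxE sumr_ge0.
  - by rewrite s1.
  - by rewrite s2; apply: eq_bigr => i _; rewrite fE.
case=> c [c0 c1 ->]; exists n, (fun i => row i V), (fun i => c 0 i).
by split=> //; rewrite mulmx_sum_row.
Qed.

Lemma conv_hull_range n d (v : 'I_n -> 'rV[R]_d) :
  conv_hull (range v) = hull (\matrix_i v i).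
Proof.
rewrite -conv_hull_rows (_ : (fun i => row i _) = v) //.
by apply: funext => i; rewrite rowK.
Qed.

Lemma aff_hull_hull n d (V : 'M[R]_(n, d)) :
  aff_hull (hull V) =
  [set x | exists2 c : 'rV[R]_n, \sum_i c 0 i = 1 & x = c *m V].
Proof.
apply/seteqP; split=> x.
  case=> m [v [c [vV c1 ->]]].
  have /choice[f fE] : forall i, exists e : 'rV[R]_n,
    \sum_j e 0 j = 1 /\ v i = e *m V.
    by move=> i; case: (vV i) => e [_ e1 ->]; exists e.
  exists (\sum_i c i *: f i).
    transitivity (\sum_i c i * \sum_j f i 0 j).
      under eq_bigr do rewrite summxE.
      rewrite exchange_big /=; apply: eq_bigr => i _.
      by rewrite mulr_sumr; apply: eq_bigr => j _; rewrite mxE.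
    by rewrite -c1; apply: eq_bigr => i _; rewrite (fE i).1 mulr1.
  by rewrite mulmx_suml; apply: eq_bigr => i _; rewrite -scalemxAl (fE i).2.
case=> c c1 ->; exists n, (fun i => row i V), (fun i => c 0 i).
by split=> //; [move=> i; exact: row_hull | rewrite mulmx_sum_row].
Qed.

Lemma affine_hull n d e (V : 'M[R]_(n, d)) (A : 'M[R]_(d, e)) (w : 'rV[R]_e) :
  [set x *m A + w | x in hull V] = hull (V *m A + const_mx 1 *m w).
Proof.
have E (c : 'rV[R]_n) : \sum_i c 0 i = 1 ->
    c *m (V *m A + const_mx 1 *m w) = c *m V *m A + w.
  move=> c1; rewrite mulmxDr !mulmxA; congr (_ + _).
  rewrite -[RHS]mul1mx; congr (_ *m _); apply/rowP => i.
  rewrite !mxE ord1 -[RHS]c1; apply: eq_bigr => j _.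
  by rewrite mxE mulr1.
apply/seteqP; split=> x.
  by case=> _ [c [c0 c1 ->]] <-; exists c; split=> //; rewrite E.
by case=> c [c0 c1 ->]; exists (c *m V); [exists c | rewrite E].
Qed.

Lemma dilate_hull n d k (V : 'M[R]_(n, d)) :
  dilate k (hull V) = hull (k%:R *: V).
Proof.
apply/seteqP; split=> x.
  by case=> _ [c [c0 c1 ->]] <-; exists c; split=> //; rewrite scalemxAr.
by case=> c [c0 c1 ->]; exists (c *m V); [exists c | rewrite scalemxAr].
Qed.

Lemma hull_row_perm n d (s : 'S_n) (V : 'M[R]_(n, d)) :
  hull (row_perm s V) = hull V.
Proof.
have sub (t : 'S_n) (W : 'M[R]_(n, d)) : hull (row_perm t W) `<=` hull W.
  move=> x [c [c0 c1 ->]]; exists (col_perm t^-1 c); split.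
  - by move=> i; rewrite mxE.
  - rewrite -c1 [RHS](reindex_inj (@perm_inj _ t^-1)) /=.
    by apply: eq_bigr => i _; rewrite mxE.
  - by rewrite mul_col_perm invgK.
apply/seteqP; split; first exact: sub.
rewrite -{1}[V](_ : row_perm s^-1 (row_perm s V) = _); first exact: sub.
by apply/matrixP => i j; rewrite !mxE permKV.
Qed.

Lemma hull_convex n d (V : 'M[R]_(n, d)) m (v : 'I_m -> 'rV[R]_d) (c : 'I_m -> R) :
  (forall i, hull V (v i)) -> (forall i, 0 <= c i) -> \sum_i c i = 1 ->
  hull V (\sum_i c i *: v i).
Proof.
move=> vV c0 c1.
have /choice[f fE] : forall i, exists e : 'rV[R]_n,
    [/\ forall j, 0 <= e 0 j, \sum_j e 0 j = 1 & v i = e *m V] by [].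
exists (\sum_i c i *: f i); split.
- move=> j; rewrite summxE sumr_ge0 // => i _.
  by rewrite mxE mulr_ge0 //; have [] := fE i.
- transitivity (\sum_i c i * \sum_j f i 0 j).
    under eq_bigr do rewrite summxE.
    rewrite exchange_big /=; apply: eq_bigr => i _.
    by rewrite mulr_sumr; apply: eq_bigr => j _; rewrite mxE.
  by rewrite -c1; apply: eq_bigr => i _; have [_ -> _] := fE i; rewrite mulr1.
- rewrite mulmx_suml; apply: eq_bigr => i _.
  by rewrite -scalemxAl; have [_ _ <-] := fE i.
Qed.

(** If x is a convex combination with a coefficient c_i strictly between 0 and
    1, it lies inside the segment from the i-th point to the normalized
    combination of the others, and extremality makes it equal to the i-th
    point. *)
Lemma vertex_conv_hull d (S : set 'rV[R]_d) x : vertex (conv_hull S) x -> S x.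
Proof.
case=> -[n [v [c [vS c0 c1 xE]]]] ext.
have [i ci] : exists i, c i != 0.
  apply/existsP; apply: contraT; rewrite negb_exists => /forallP c00.
  move: c1; rewrite big1 => [/eqP|i _]; first by rewrite eq_sym oner_eq0.
  by apply/eqP; have := c00 i; rewrite negbK.
have c1i : \sum_(j | j != i) c j = 1 - c i.
  by move: c1; rewrite (bigD1 i) //= => <-; ring.
have [ci1|ci1] := eqVneq (c i) 1.
  have cj j : j != i -> c j = 0.
    move: c1i; rewrite ci1 subrr => /eqP.
    rewrite psumr_eq0 // => /allP /(_ j (mem_index_enum _)) /implyP h ji.
    by apply/eqP/h.
  rewrite xE (bigD1 i) //= ci1 scale1r big1 ?addr0 // => j ji.
  by rewrite cj // scale0r.
have ci2 : 0 < c i < 1.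
  rewrite lt_neqAle eq_sym ci c0 /= lt_neqAle ci1 -subr_ge0 -c1i.
  by rewrite sumr_ge0.
have ci3 : 1 - c i != 0 by rewrite subr_eq0 eq_sym.
have [] := ext (v i) (\sum_j (if j == i then 0 else c j / (1 - c i)) *: v j)
  (c i) _ _ ci2.
- exists 1%N, (fun=> v i), (fun=> 1); split=> //; rewrite ?big_ord1 ?scale1r //.
- exists n, v, (fun j => if j == i then 0 else c j / (1 - c i)); split=> //.
    move=> j; case: ifP => // _; rewrite divr_ge0 // subr_ge0.
    by case/andP: ci2 => _ /ltW.
  rewrite (bigD1 i) //= eqxx add0r.
  rewrite (eq_bigr (fun j => c j / (1 - c i))); last by move=> j /negPf ->.
  by rewrite -mulr_suml c1i divff.
- rewrite xE (bigD1 i) //= [X in _ = _ + _ *: X](bigD1 i) //= eqxx scale0r add0r.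
  congr (_ + _); rewrite scaler_sumr; apply: eq_bigr => j /negPf ->.
  by rewrite scalerA mulrCA divff // mulr1.
by move=> <- _.
Qed.

End Hull.

(** * Barycentric coordinates in a simplex *)

(** The matrix with rows (1, v_i). It is invertible if and only if the v_i are
    the vertices of a full-dimensional simplex. *)
Definition homog (K : pzRingType) (d : nat) (V : 'M[K]_(d.+1, d)) : 'M[K]_d.+1 :=
  row_mx (const_mx 1 : 'cV_d.+1) V.

Lemma mul_homog (K : pzRingType) d m (c : 'M[K]_(m, d.+1)) (V : 'M[K]_(d.+1, d)) :
  c *m homog V = row_mx (c *m (const_mx 1 : 'cV_d.+1)) (c *m V) :> 'M[K]_(m, 1 + d).
Proof. exact: mul_mx_row. Qed.

Lemma mul_ones (K : pzRingType) n (c : 'rV[K]_n) :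
  c *m (const_mx 1 : 'cV_n) = (\sum_i c 0 i)%:M.
Proof.
rewrite mulmx_sum_row [RHS]mx11_scalar !mxE eqxx mulr1n.
apply/matrixP => i j; rewrite !ord1 !mxE eqxx mulr1n summxE.
by apply: eq_bigr => k _; rewrite !mxE mulr1.
Qed.

Lemma eq_row_mx1 (K : pzRingType) d (h k : K) (x y : 'rV[K]_d) :
  row_mx h%:M x = row_mx k%:M y :> 'rV[K]_(1 + d) -> h = k /\ x = y.
Proof.
move=> E; have [/matrixP/(_ 0 0) + ->] := eq_row_mx E.
by rewrite !mxE eqxx !mulr1n.
Qed.

Section Simplex.
Variables (R : realType) (d : nat).
Implicit Type V : 'M[R]_(d.+1, d).

(** The coordinates t with (h, x) = sum_i t_i (1, v_i); for h = 1 these are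
    the barycentric coordinates of x. *)
Definition bary V (h : R) (x : 'rV[R]_d) : 'rV[R]_d.+1 :=
  (row_mx h%:M x : 'rV_(1 + d)) *m invmx (homog V).

Lemma baryE V (h : R) (x : 'rV[R]_d) (c : 'rV[R]_d.+1) :
  homog V \in unitmx ->
  (bary V h x = c) <-> (\sum_i c 0 i = h /\ c *m V = x).
Proof.
move=> uV; rewrite /bary; split=> [<-|[<- <-]].
  set b := _ *m _.
  have : b *m homog V = row_mx h%:M x by rewrite mulmxKV.
  by rewrite mul_homog mul_ones; apply: eq_row_mx1.
by rewrite -mul_ones -(mul_homog c V) mulmxK.
Qed.

Lemma sum_bary V h x : homog V \in unitmx -> \sum_i bary V h x 0 i = h.
Proof. by move=> uV; have [->] := (baryE h x (bary V h x) uV).1 erefl. Qed.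

Lemma bary_mul V h x : homog V \in unitmx -> bary V h x *m V = x.
Proof. by move=> uV; have [] := (baryE h x (bary V h x) uV).1 erefl. Qed.

Lemma baryK V (c : 'rV[R]_d.+1) : homog V \in unitmx ->
  bary V (\sum_i c 0 i) (c *m V) = c.
Proof. by move=> uV; apply/baryE. Qed.

Lemma hullE V x : homog V \in unitmx ->
  hull V x <-> forall i, 0 <= bary V 1 x 0 i.
Proof.
move=> uV; split=> [[c [c0 c1 ->]] i|b0]; first by rewrite -c1 baryK.
by exists (bary V 1 x); split; rewrite // ?sum_bary ?bary_mul.
Qed.

Lemma baryZ V a h x : bary V (a * h) (a *: x) = a *: bary V h x.
Proof. by rewrite /bary scalemxAl scale_row_mx scale_scalar_mx. Qed.

Lemma baryD V h k x y : bary V (h + k) (x + y) = bary V h x + bary V k y.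
Proof. by rewrite /bary -mulmxDl add_row_mx raddfD. Qed.

Lemma bary0 V : bary V 0 0 = 0.
Proof. by have := baryZ V 0 0 0; rewrite mul0r !scale0r. Qed.

Lemma bary_sum_delta V x :
  bary V 1 x = bary V 1 0 + \sum_j x 0 j *: bary V 0 (delta_mx 0 j).
Proof.
rewrite {1}[x]row_sum_delta -[in LHS](addr0 1) -[X in bary V _ X]add0r baryD.
congr (_ + _); elim/big_rec2: _ => [|j u v _ <-]; first exact: bary0.
by rewrite -baryZ -baryD mulr0 addr0.
Qed.

Lemma bary_row V i : homog V \in unitmx -> bary V 1 (row i V) = delta_mx 0 i.
Proof.
move=> uV; apply/baryE => //; rewrite rowE; split=> //.
rewrite (bigD1 i) //= mxE !eqxx big1 ?addr0 // => j /negPf ji.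
by rewrite mxE ji andbF.
Qed.

Lemma dilateE V n x : homog V \in unitmx -> (0 < n)%N ->
  dilate n (hull V) x <-> forall i, 0 <= bary V n%:R x 0 i.
Proof.
move=> uV n0; have n0' : n%:R != 0 :> R by rewrite pnatr_eq0 -lt0n.
have E y : bary V n%:R (n%:R *: y) = n%:R *: bary V 1 y.
  by rewrite -[X in bary V X _]mulr1 baryZ.
split=> [[y /hullE hy <-] i|b0].
  by rewrite E mxE mulr_ge0 // hy.
exists (n%:R^-1 *: x); last by rewrite scalerA divff // scale1r.
apply/hullE => // i; have := b0 i.
have -> : bary V n%:R x = n%:R *: bary V 1 (n%:R^-1 *: x).
  by rewrite -E scalerA divff // scale1r.
by rewrite mxE pmulr_rge0 // ltr0n.
Qed.

Lemma homog_unit_simplex V : homog V \in unitmx -> simplex (hull V).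
Proof.
move=> uV; exists d, (fun i => row i V); rewrite conv_hull_rows; split=> //.
move=> c c0 cV i.
have : (\row_i c i) *m homog V = 0.
  rewrite mul_homog mul_ones mulmx_sum_row.
  rewrite (eq_bigr c) ?c0; last by move=> j _; rewrite mxE.
  rewrite (eq_bigr (fun i => c i *: row i V)) ?cV.
    by rewrite -scalemx1 scale0r row_mx0.
  by move=> j _; rewrite mxE.
move/(congr1 (mulmx^~ (invmx (homog V)))); rewrite mulmxK // mul0mx.
by move/rowP/(_ i); rewrite !mxE.
Qed.

Lemma homog_unit_dim V : homog V \in unitmx -> has_dim (hull V) d.
Proof.
move=> uV; exists 0, fullv; split.
  by rewrite dimvf /dim /= mul1n.
rewrite aff_hull_hull; apply/seteqP; split=> x _.
  by exists x; rewrite /= ?add0r ?memvf.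
by exists (bary V 1 x); rewrite ?sum_bary ?bary_mul.
Qed.

(** Affine independence makes the rows of the homogenized matrix independent,
    and full dimension makes them span, so the number of vertices is d + 1. *)
Lemma simplex_homog (P : set 'rV[R]_d) : simplex P -> has_dim P d ->
  exists2 V : 'M[R]_(d.+1, d), homog V \in unitmx & P = hull V.
Proof.
move=> [k [v [indep PE]]] [p [U [dU aP]]].
have UT : U = fullv.
  by apply/eqP; rewrite -(geq_leqif (dimv_leqif_eq (subvf U))) dU dimvf /dim /= mul1n.
rewrite conv_hull_range in PE; set V := \matrix_i v i in PE.
pose M : 'M[R]_(k.+1, 1 + d) := row_mx (const_mx 1 : 'cV_k.+1) V.
have full : row_full M.
  have rep x : exists c : 'rV_k.+1, c *m M = row_mx 1%:M x.
    have : aff_hull P x.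
      by rewrite aP; exists (x - p); rewrite /= ?UT ?memvf // addrC subrK.
    rewrite PE aff_hull_hull => -[c c1 ->]; exists c.
    by rewrite mul_mx_row mul_ones c1.
  rewrite -sub1mx; apply/row_subP => i; move: (row i _) => w.
  have [c cM] := rep (rsubmx w); have [e eM] := rep 0.
  apply/submxP; exists (c + (w 0 (lshift d 0) - 1) *: e).
  rewrite mulmxDl -scalemxAl cM eM scale_row_mx add_row_mx scaler0 addr0.
  rewrite -[LHS]hsubmxK; congr row_mx.
  apply/matrixP => a b; rewrite !ord1 !mxE eqxx mulr1n.
  by rewrite mulr1 addrC subrK.
have free : row_free M.
  apply: inj_row_free => c cM.
  move: cM; rewrite mul_mx_row mul_ones mulmx_sum_row -[RHS]row_mx0.
  have z0 : (0 : 'M[R]_1) = 0%:M by rewrite raddf0.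
  rewrite z0 => /eq_row_mx1[c1 c2].
  apply/rowP => i; rewrite mxE; apply: (indep (fun i => c 0 i)) => //.
  by rewrite -[RHS]c2; apply: eq_bigr => j _; rewrite rowK.
have kd : k = d.
  by apply/eqP; move: free full; rewrite /row_free /row_full => /eqP -> /eqP[->].
by subst k; exists V; rewrite // -row_free_unit.
Qed.

Lemma vertex_hull V x : homog V \in unitmx ->
  vertex (hull V) x <-> exists i, x = row i V.
Proof.
move=> uV; split.
  by rewrite -conv_hull_rows => /vertex_conv_hull[i _ <-]; exists i.
case=> i ->; split; first exact: row_hull.
have half (y z : 'rV[R]_d) (t : R) : hull V y -> hull V z -> 0 < t < 1 ->
    row i V = t *: y + (1 - t) *: z -> y = row i V.
  move=> /hullE-/(_ uV) hy /hullE-/(_ uV) hz /andP[t0 t1] E.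
  have b : delta_mx 0 i = t *: bary V 1 y + (1 - t) *: bary V 1 z.
    rewrite -(bary_row i uV) E -!baryZ -baryD; congr (bary V _ _).
    by ring.
  have bj j : j != i -> bary V 1 y 0 j = 0.
    move: (bary V 1 y) (bary V 1 z) hy hz b => u w u0 w0 b ji.
    have /rowP /(_ j) := b; rewrite !mxE (negPf ji) andbF => /eqP.
    rewrite eq_sym paddr_eq0; last 2 first.
    - by apply: mulr_ge0; rewrite ?u0 // ltW.
    - by apply: mulr_ge0; rewrite ?w0 // subr_ge0 ltW.
    by rewrite mulf_eq0 gt_eqF //= => /andP[/eqP].
  have bi : bary V 1 y 0 i = 1.
    transitivity (\sum_j bary V 1 y 0 j); last exact: sum_bary.
    by rewrite (bigD1 i) //= big1 ?addr0 // => j; exact: bj.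
  rewrite -(bary_mul 1 y uV) rowE; congr (_ *m _); apply/rowP => j.
  rewrite [RHS]mxE eqxx /=; have [->|ji] := eqVneq j i; first exact: bi.
  exact: bj.
move=> y z t hy hz t01 E; split; first exact: half hy hz t01 E.
apply: (half z y (1 - t)) => //.
  by case/andP: t01 => t0 t1; rewrite subr_gt0 t1 ltrBlDr ltrDl.
by rewrite E addrC; congr (_ + _); congr (_ *: _); ring.
Qed.

Lemma polytope_hull n (V : 'M[R]_(n, d)) : polytope (hull V).
Proof.
exists (range (fun i => row i V)); last by rewrite conv_hull_rows.
exact: finite_image.
Qed.

Lemma lattice_polytope_hull V : homog V \in unitmx ->
  lattice_polytope (hull V) <-> exists Z : 'M[int]_(d.+1, d), V = map_mx intr Z.
Proof.
move=> uV; split=> [[_ lat]|[Z VE]].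
  have /choice[f fE] : forall i, exists z : 'rV[int]_d, row i V = map_mx intr z.
    move=> i; case: (lat (row i V)); first by apply/vertex_hull => //; exists i.
    by move=> z _ <-; exists z.
  exists (\matrix_i f i); apply/row_matrixP => i.
  by rewrite fE -map_row rowK.
split; first exact: polytope_hull.
move=> x /vertex_hull-/(_ uV)[i ->]; rewrite VE; exists (row i Z) => //.
by rewrite map_row.
Qed.

End Simplex.

(** * Interior and polar dual of a simplex *)

Section Interior.
Variables (R : realType) (d : nat).
Implicit Type V : 'M[R]_(d.+1, d).

Lemma bary_continuous V h i : continuous (fun x => bary V h x 0 i).
Proof.
move=> x; rewrite (_ : (fun y => _) = fun y : 'rV[R]_d =>
   h * invmx (homog V) (lshift d 0 : 'I_(1 + d)) i +
   \sum_j y 0 j * invmx (homog V) (rshift 1 j : 'I_(1 + d)) i).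
  apply: (cvgD (F := nbhs x)); first exact: cvg_cst.
  apply: (@cvg_big _ _ _ _ _ _ _ (nbhs x)) => [|j _]; first exact: add_continuous.
  apply: (cvgM (F := nbhs x)); last exact: cvg_cst.
  exact: (@coord_continuous R 1 d 0 j x).
apply: funext => y; rewrite /bary mxE big_split_ord /= big_ord1.
congr (_ + _); first by rewrite row_mxEl mxE mulr1n.
by apply: eq_bigr => j _; rewrite row_mxEr.
Qed.

(** Moving from x away from the i-th vertex decreases the i-th coordinate below
    zero as soon as it vanishes at x. *)
Lemma interiorE V n x : homog V \in unitmx -> (0 < n)%N ->
  (dilate n (hull V))° x <-> forall i, 0 < bary V n%:R x 0 i.
Proof.
move=> uV n0; split=> [|b0]; last first.
  have : \forall y \near x, forall i, 0 < bary V n%:R y 0 i.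
    apply: (@filter_forall _ _ _ (nbhs x)) => i.
    have bx := @bary_continuous V n%:R i x.
    exact: (cvgr_gt (FF := nbhs_filter x) _ bx _ (b0 i)).
  apply: (@filterS _ (nbhs x)) => y by0.
  by apply/(dilateE _ uV n0) => i; exact: ltW.
move=> xint i; pose u := x - n%:R *: row i V.
have : \forall s \near 0^'+, dilate n (hull V) (x + s *: u).
  have cs : x + s *: u @[s --> 0^'+] --> x.
    rewrite -[X in _ --> X]addr0 -[X in _ + X](scale0r u).
    apply: (cvgD (F := 0^'+)); first exact: cvg_cst.
    apply: (cvgZ (F := 0^'+)); last exact: cvg_cst.
    exact: cvg_at_right_filter.
  exact: (cs _ xint).
move=> near_s.
have [s [s0 /dilateE-/(_ uV n0) /(_ i)]] :
    exists s, 0 < s /\ dilate n (hull V) (x + s *: u).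
  near (0 : R)^'+ => s; exists s; split => //.
  by near: s; exact: near_s.
rewrite (_ : bary V _ _ =
    (1 + s) *: bary V n%:R x - (s * n%:R) *: bary V 1 (row i V)).
  rewrite bary_row //; move: (bary V _ _) => b; rewrite !mxE !eqxx mulr1 subr_ge0.
  rewrite -(pmulr_rgt0 (b 0 i) (_ : 0 < 1 + s)) ?addr_gt0 //.
  by apply: lt_le_trans; rewrite mulr_gt0 // ltr0n.
rewrite -scaleNr -!baryZ -baryD; congr (bary V _ _); first by ring.
by rewrite /u scalerBr scalerDl scale1r !scalerA scaleNr addrA.
Unshelve. all: by end_near.
Qed.

End Interior.

Definition dot (R : realType) (d : nat) (x y : 'rV[R]_d) : R :=
  \sum_i x 0 i * y 0 i.

Section Polar.
Variables (R : realType) (d : nat) (V : 'M[R]_(d.+1, d)).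
Hypothesis uV : homog V \in unitmx.
Hypothesis V0 : forall i, 0 < bary V 1 0 0 i.

(** The coordinate t_i is an affine function of x with value t_i(0) at the
    origin. Hence t_i(x) >= 0 can be rewritten as <x, y_i> <= 1, where y_i is
    minus the linear part of t_i divided by t_i(0). *)
Definition polar_vertices : 'M[R]_(d.+1, d) :=
  \matrix_(i, j) (- (bary V 1 0 0 i)^-1 * bary V 0 (delta_mx 0 j) 0 i).

Let dot_suml n (c : 'rV[R]_n) (A : 'M[R]_(n, d)) y :
  dot (c *m A) y = \sum_i c 0 i * dot (row i A) y.
Proof.
rewrite /dot; under eq_bigr do rewrite mxE mulr_suml.
rewrite exchange_big /=; apply: eq_bigr => i _; rewrite mulr_sumr.
by apply: eq_bigr => j _; rewrite mxE mulrA.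
Qed.

Let dot_sumr n (c : 'rV[R]_n) (A : 'M[R]_(n, d)) x :
  dot x (c *m A) = \sum_i c 0 i * dot x (row i A).
Proof.
have C y z : dot y z = dot z y by apply: eq_bigr => i _; rewrite mulrC.
by rewrite C dot_suml; apply: eq_bigr => i _; rewrite C.
Qed.

Lemma dot_polar_vertices x i :
  dot x (row i polar_vertices) = 1 - bary V 1 x 0 i / bary V 1 0 0 i.
Proof.
rewrite bary_sum_delta; set b := bary V 1 0.
rewrite [X in X / _]mxE mulrDl divff ?gt_eqF ?V0 // opprD addrA subrr add0r.
rewrite summxE mulr_suml -sumrN; apply: eq_bigr => j _.
rewrite [X in _ = - (X / _)]mxE [row _ _ _ _]mxE [polar_vertices _ _]mxE -/b.
by ring.
Qed.

Let dot_row_polar j i :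
  dot (row j V) (row i polar_vertices) = 1 - (i == j)%:R / bary V 1 0 0 i.
Proof. by rewrite dot_polar_vertices bary_row // mxE. Qed.

Let dot_inj y z : (forall j, dot (row j V) y = dot (row j V) z) -> y = z.
Proof.
move=> yz; have yzP x : dot x y = dot x z.
  by rewrite -(bary_mul 1 x uV) !dot_suml; apply: eq_bigr => j _; rewrite yz.
apply/rowP => i; have := yzP (delta_mx 0 i).
have E w : dot (delta_mx 0 i) w = w 0 i.
  rewrite /dot (bigD1 i) //= mxE !eqxx mul1r big1 ?addr0 // => j /negPf ji.
  by rewrite mxE ji andbF mul0r.
by rewrite !E.
Qed.

Let dot_row_comb j (c : 'rV[R]_d.+1) :
  dot (row j V) (c *m polar_vertices) =
  \sum_i c 0 i - c 0 j / bary V 1 0 0 j.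
Proof.
rewrite dot_sumr; under eq_bigr do rewrite dot_row_polar mulrBr mulr1.
rewrite sumrB; congr (_ - _); rewrite (bigD1 j) //= eqxx mul1r big1 ?addr0 //.
by move=> i /negPf ->; rewrite mul0r mulr0.
Qed.

Lemma homog_polar_unit : homog polar_vertices \in unitmx.
Proof.
rewrite -row_free_unit; apply: inj_row_free => c cM.
have [c1 cY] : \sum_i c 0 i = 0 /\ c *m polar_vertices = 0.
  by apply: eq_row_mx1; rewrite -mul_ones -mul_homog cM raddf0 row_mx0.
apply/rowP => j; rewrite [RHS]mxE; have := dot_row_comb j c.
rewrite cY c1 sub0r /dot big1.
  move/esym/eqP; rewrite oppr_eq0 mulf_eq0 invr_eq0 [X in _ || X]gt_eqF //.
  by rewrite orbF => /eqP.
by move=> i _; rewrite [X in _ * X]mxE mulr0.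
Qed.

(** A point y of the dual is the combination of the y_i with coefficients
    t_i(0) (1 - <v_i, y>): both sides have the same product with every v_j. *)
Lemma polar_hull : polar_dual (hull V) = hull polar_vertices.
Proof.
apply/seteqP; split=> y.
  move=> hy; pose c := \row_i (bary V 1 0 0 i * (1 - dot (row i V) y)).
  have c1 : \sum_i c 0 i = 1.
    under eq_bigr do rewrite mxE mulrBr mulr1.
    rewrite sumrB sum_bary // -dot_suml bary_mul // /dot big1 ?subr0 // => i _.
    by rewrite mxE mul0r.
  exists c; split=> //.
    move=> i; rewrite mxE mulr_ge0 ?(ltW (V0 i)) // subr_ge0.
    exact: (hy _ (row_hull V i)).
  apply: dot_inj => j; rewrite dot_row_comb c1 mxE mulrC mulKf ?gt_eqF //.
  by ring.
case=> c [c0 c1 ->] x /hullE-/(_ uV) bx.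
rewrite -[X in X <= _]/(dot _ _) dot_sumr -[X in _ <= X]c1 ler_sum // => i _.
rewrite -[X in _ <= X]mulr1 ler_wpM2l // dot_polar_vertices gerBl.
by rewrite divr_ge0 ?bx // ltW.
Qed.

(** The polar dual is again a simplex, so it is a lattice polytope if and only
    if the y_i are lattice points. *)
Lemma lattice_polar :
  lattice_polytope (polar_dual (hull V)) <->
  exists Y : 'M[int]_(d.+1, d), polar_vertices = map_mx intr Y.
Proof. by rewrite polar_hull; apply: lattice_polytope_hull homog_polar_unit. Qed.

End Polar.

(** * Gorenstein simplices and unit fractions *)

Lemma exists_neq_ord d (i : 'I_d.+1) : (0 < d)%N -> exists k : 'I_d.+1, i != k.
Proof.
move=> d0; have [->|i0] := eqVneq i ord0; last by exists ord0.
by exists ord_max; rewrite eq_sym -val_eqE /= -lt0n.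
Qed.

Lemma det_pm1_unit n (U : 'M[int]_n) : \det U = 1 \/ \det U = -1 -> U \in unitmx.
Proof. by rewrite unitmxE => -[] ->; rewrite ?unitrN unitr1. Qed.

Lemma map_intr_unitmx (R : realType) n (U : 'M[int]_n) :
  U \in unitmx -> map_mx intr U \in @unitmx R n.
Proof. by rewrite !unitmxE det_map_mx => uU; rewrite rmorph_unit. Qed.

Section Affine.
Variables (R : realType) (d : nat).
Implicit Type V : 'M[R]_(d.+1, d).

Lemma homog_affine V (r : R) (U : 'M[R]_d) (w : 'rV[R]_d) :
  homog V \in unitmx -> r != 0 -> U \in unitmx ->
  homog ((r *: V) *m U + const_mx 1 *m w) \in unitmx.
Proof.
move=> uV r0 uU.
rewrite (_ : homog _ =
    homog V *m (block_mx 1%:M w 0 (r *: U) : 'M[R]_(1 + d))).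
  rewrite unitmx_mul uV unitmxE (@det_ublock _ 1 d) det1 mul1r detZ unitrM.
  by rewrite -unitmxE uU unitfE expf_neq0.
rewrite /homog [RHS](@mul_row_block _ d.+1 1 d 1 d) mulmx1 mulmx0 addr0 addrC.
by rewrite -scalemxAl scalemxAr.
Qed.

Lemma bary_affine V (r : R) (U : 'M[R]_d) (w y : 'rV[R]_d) (h : R) :
  homog V \in unitmx -> r != 0 -> U \in unitmx ->
  bary ((r *: V) *m U + const_mx 1 *m w) h (y *m U + h *: w) =
  r^-1 *: bary V (h * r) y.
Proof.
move=> uV r0 uU; apply/baryE; first exact: homog_affine.
have S : \sum_i (r^-1 *: bary V (h * r) y) 0 i = h.
  transitivity (r^-1 * \sum_i bary V (h * r) y 0 i).
    by rewrite mulr_sumr; apply: eq_bigr => i _; rewrite [LHS]mxE.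
  by rewrite sum_bary // mulrC mulfK.
split=> //; rewrite mulmxDr !mulmxA mul_ones S mul_scalar_mx; congr (_ + _).
by rewrite -scalemxAl -scalemxAr scalerA mulVf // scale1r bary_mul.
Qed.

End Affine.

Section Codegree.
Variables (R : realType) (d : nat) (V : 'M[int]_(d.+1, d)).
Let VR : 'M[R]_(d.+1, d) := map_mx intr V.
Hypothesis uV : homog VR \in unitmx.

Definition interior_lattice_point (n : nat) (z : 'rV[int]_d) :=
  forall i, 0 < bary VR n%:R (map_mx intr z) 0 i.

(** The sum of the vertices is an interior lattice point of the dilate by
    d + 1, so the set whose minimum defines the codegree is not empty. *)
Lemma codegP : [/\ (0 < codeg (hull VR))%N,
  exists z, interior_lattice_point (codeg (hull VR)) z
  & forall m z, (0 < m)%N -> interior_lattice_point m z ->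
      (codeg (hull VR) <= m)%N].
Proof.
rewrite /codeg.
set A := [set n : nat | (0 < n)%N /\ (dilate n (hull VR))° `&` _ !=set0].
set B := [set n | A n /\ forall m, A m -> (n <= m)%N].
have AE n : A n <-> (0 < n)%N /\ exists z, interior_lattice_point n z.
  split=> -[n0]; rewrite /A /=.
    case=> x [/(interiorE x uV n0) xn [z _ zx]]; split=> //.
    by exists z; rewrite /interior_lattice_point zx.
  case=> z zn; split=> //; exists (map_mx intr z); split; last by exists z.
  exact/interiorE.
have Ad : A d.+1.
  apply/AE; split=> //; exists (\sum_i row i V) => i.
  suff -> : bary VR d.+1%:R (map_mx intr (\sum_i row i V)) = const_mx 1.
    by rewrite mxE.
  apply/baryE => //; split.
    rewrite (eq_bigr (fun=> 1)); last by move=> j _; rewrite mxE.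
    by rewrite sumr_const card_ord.
  rewrite mulmx_sum_row raddf_sum; apply: eq_bigr => j _.
  by rewrite [const_mx _ _ _]mxE scale1r /= map_row.
have exA : exists n, `[< A n >] by exists d.+1; apply/asboolP.
have [c /asboolP Ac cmin] := ex_minnP exA.
have : B (xget 0%N B).
  apply: xgetI (c) _; split=> // m Am; apply: cmin; exact/asboolP.
case=> /AE[c0 cz] min; split=> // m z m0 mz.
by apply: min; apply/AE; split=> //; exists z.
Qed.

Lemma codeg_eq r z : (0 < r)%N -> interior_lattice_point r z ->
  (forall m z, (0 < m)%N -> interior_lattice_point m z -> (r <= m)%N) ->
  codeg (hull VR) = r.
Proof.
move=> r0 rz rmin; have [c0 [y cy] cmin] := codegP.
by apply/eqP; rewrite eqn_leq (rmin _ y) // (cmin _ z).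
Qed.

End Codegree.

Section Gorenstein.
Variables (R : realType) (d : nat) (V : 'M[int]_(d.+1, d)).
Let VR : 'M[R]_(d.+1, d) := map_mx intr V.
Hypothesis uV : homog VR \in unitmx.
Hypothesis d0 : (0 < d)%N.

(** Adding multiples of (1, v_k) for some k <> i changes the height but not the
    i-th coordinate, so the values of the i-th coordinate on lattice points can
    be studied at a single height. *)
Lemma bary_facet_lattice (T : R -> Prop) (i : 'I_d.+1) (r : R) :
  (exists n : int, r = n%:~R) ->
  (forall y : 'rV[int]_d, T (bary VR r (map_mx intr y) 0 i)) ->
  forall (h : int) (x : 'rV[int]_d), T (bary VR h%:~R (map_mx intr x) 0 i).
Proof.
move=> [n ->] Ty h x.
have [k ki] := exists_neq_ord i d0.
have := Ty (x + (n - h) *: row k V).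
suff -> : bary VR n%:~R (map_mx intr (x + (n - h) *: row k V)) =
    bary VR h%:~R (map_mx intr x) + (n - h)%:~R *: delta_mx 0 k.
  rewrite mxE [X in _ + X]mxE [delta_mx _ _ _ _]mxE (negPf ki) andbF mulr0.
  by rewrite addr0.
rewrite -(bary_row k uV) -baryZ -baryD mulr1 -intrD (addrC h) subrK.
by rewrite raddfD /= map_mxZ map_row.
Qed.

(** Let the reflexive polytope Q be the image of rP, and let z be the point of
    rP sent to the origin. As the vertices of the polar dual of Q are lattice
    points, t_i is an integral multiple of t_i(z) at all lattice points. As
    t_i(v_i) = 1, t_i(z) is a unit fraction. Every interior lattice point at
    height m has coordinates at least those of z, so m >= r, and r is the
    codegree. *)
Lemma gorenstein_unit_fractions : gorenstein (hull VR) ->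
  exists (z : 'rV[int]_d) (b : 'I_d.+1 -> nat),
  [/\ forall i, (0 < b i)%N,
      forall i, bary VR (codeg (hull VR))%:R (map_mx intr z) 0 i = (b i)%:R^-1
    & forall i (h : int) (x : 'rV[int]_d), exists m : int,
        bary VR h%:~R (map_mx intr x) 0 i = m%:~R / (b i)%:R].
Proof.
case=> _ _ [r [r1 [Q [[U [w [/det_pm1_unit uU QE]]] [_ _ Q0 latQ]]]]].
have r0 : r%:R != 0 :> R by rewrite pnatr_eq0 -lt0n.
have uUR : map_mx intr U \in @unitmx R d by exact: map_intr_unitmx.
move: QE; rewrite dilate_hull affine_hull; set W := (X in hull X) => QE.
have uW : homog W \in unitmx by apply: homog_affine.
(* The lattice point of the dilated simplex that is sent to the origin. *)
pose y0 := - w *m invmx U.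
have y0E : map_mx intr y0 *m map_mx intr U + 1 *: map_mx intr w = 0 :> 'rV[R]_d.
  by rewrite -map_mxM mulmxKV // scale1r -raddfD addNr raddf0.
have bW (y : 'rV[int]_d) :
    bary W 1 (map_mx intr (y *m U + w)) = r%:R^-1 *: bary VR r%:R (map_mx intr y).
  rewrite raddfD /= map_mxM -[X in _ + X]scale1r bary_affine //.
  by rewrite mul1r.
have W0 i : 0 < bary W 1 0 0 i.
  suff : (dilate 1 (hull W))° 0 by move=> /(interiorE _ uW (isT : (0 < 1)%N)) /(_ i).
  by rewrite dilate_hull scale1r -QE.
move: latQ; rewrite QE => /(lattice_polar uW W0)[Y YE].
pose t i := bary VR r%:R (map_mx intr y0) 0 i.
have bW0 i : bary W 1 0 0 i = r%:R^-1 * t i.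
  have := bW y0; rewrite raddfD /= map_mxM -[X in _ + X]scale1r y0E => ->.
  by rewrite mxE.
have t0 i : 0 < t i by have := W0 i; rewrite bW0 pmulr_rgt0 // invr_gt0 ltr0n.
have tr (y : 'rV[int]_d) i : exists m : int,
    bary VR r%:R (map_mx intr y) 0 i = m%:~R * t i.
  have := dot_polar_vertices W0 (map_mx intr (y *m U + w)) i.
  rewrite YE bW mxE bW0 /dot; set s := \sum_j _.
  have -> : s = (\sum_j (y *m U + w) 0 j * Y i j)%:~R.
    rewrite /s rmorph_sum; apply: eq_bigr => j _.
    by rewrite rmorphM ![map_mx _ _ _ _]mxE [row _ _ _ _]mxE ![map_mx _ _ _ _]mxE.
  move: (\sum_j _) => m mE; exists (1 - m).
  rewrite intrB mE opprB addrCA subrr addr0 -mulf_div divff ?invr_eq0 // mul1r.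
  by rewrite divfK // gt_eqF.
have tz i (h : int) (x : 'rV[int]_d) : exists m : int,
    bary VR h%:~R (map_mx intr x) 0 i = m%:~R * t i.
  apply: (bary_facet_lattice (T := fun u => exists m : int, u = m%:~R * t i)
            (r := r%:R)) => //.
  by exists r%:Z.
have /choice[b bE] : forall i, exists b : nat, (0 < b)%N /\ t i = b%:R^-1.
  move=> i; have [m] := tz i 1 (row i V).
  rewrite map_row mulr1z bary_row // mxE !eqxx => m1.
  have m0 : 0 < m by rewrite -(ltr0z R) -(pmulr_lgt0 _ (t0 i)) -m1.
  case: m m0 m1 => // b b0 b1; exists b; split=> //.
  apply: (mulfI (_ : b%:R != 0)); first by rewrite pnatr_eq0 -lt0n.
  by rewrite divff ?pnatr_eq0 -?lt0n // b1.
have cr : codeg (hull VR) = r.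
  apply: (codeg_eq uV r1 (z := y0)) => // m z m0 mz.
  rewrite -(ler_nat R) -(sum_bary r%:R (map_mx intr y0) uV).
  rewrite -(sum_bary m%:R (map_mx intr z) uV) ler_sum // => i _.
  have := mz i; have [k] := tz i m z; rewrite -pmulrn => ->.
  rewrite pmulr_lgt0 // ltr0z => k0; rewrite -[X in X <= _]mul1r ler_pM2r //.
  by rewrite ler1z.
exists y0, b; split=> [i|i|i h x]; first by have [] := bE i.
  by rewrite cr; have [_ <-] := bE i.
by have [_ <-] := bE i; apply: tz.
Qed.

End Gorenstein.

(** * Lattice pyramids *)

(** In the Smith normal form of a column with coprime entries the only
    invariant factor is a unit, so that the column is, up to this unit, the
    first column of the left transformation matrix. *)
Lemma primitive_col_completion n (u : 'rV[int]_n.+1) (a : 'cV[int]_n.+1) :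
  u *m a = 1%:M -> exists2 U : 'M[int]_n.+1, U \in unitmx & col ord_max U = a.
Proof.
move=> ua; have [L uL [T uT [s _ aE]]] := int_Smith_normal_form a.
pose e := s`_0 * T 0 0.
have aL : a = e *: col 0 L.
  rewrite aE; apply/matrixP => i j; rewrite ord1 !mxE big_ord1 !mxE.
  rewrite (bigD1 ord0) //= mxE eqxx mulr1n big1 => [|k /negPf k0].
    by rewrite addr0 /e; ring.
  by rewrite mxE -val_eqE in k0 *; rewrite k0 mulr0n mulr0.
have ue : e \is a GRing.unit.
  apply/unitrP; exists ((u *m col 0 L) 0 0).
  suff E : e * (u *m col 0 L) 0 0 = 1 by split=> //; rewrite mulrC.
  by have /matrixP /(_ 0 0) := ua; rewrite aL -scalemxAr !mxE.
exists (e *: xcol ord0 ord_max L).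
  by rewrite unitmxZ // unitmxE xcolE det_mulmx unitrM -!unitmxE uL unitmx_perm.
by rewrite aL; apply/colP => i; rewrite !mxE tpermR.
Qed.

Lemma unitmx_det_pm1 n (U : 'M[int]_n) : U \in unitmx -> \det U = 1 \/ \det U = -1.
Proof.
rewrite unitmxE unfold_in /= => /orP[] /eqP; by [left | right].
Qed.

Section Append.
Variables (R : realType) (d : nat).

Lemma append_last (y : 'rV[R]_d) t : append y t 0 ord_max = t.
Proof. by rewrite mxE unlift_none. Qed.

Lemma append_lift (y : 'rV[R]_d) t j : append y t 0 (lift ord_max j) = y 0 j.
Proof. by rewrite mxE liftK. Qed.

Lemma eq_append (y : 'rV[R]_d) t (x : 'rV[R]_d.+1) :
  x 0 ord_max = t -> (forall j, x 0 (lift ord_max j) = y 0 j) -> x = append y t.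
Proof.
move=> xt xy; apply/rowP => i; case: (unliftP ord_max i) => [j|] ->.
  by rewrite append_lift.
by rewrite append_last.
Qed.

End Append.

Section Pyramid.
Variable R : realType.

(** The dimension of Q is an index of the predicate, so the dimension of the
    base can only be named after matching on it. *)
Lemma iterated_Pyr_inv d0 (P0 : set 'rV[R]_d0) d (Q : set 'rV[R]_d) :
  iterated_Pyr P0 Q ->
  match d return set 'rV[R]_d -> Prop with
  | 0 => fun _ => False
  | n.+1 => fun Q => exists P : set 'rV[R]_n, Q = Pyr P
  end Q.
Proof. by case=> [|n P _]; [exists P0 | exists P]. Qed.

(** If the i-th coordinate is integral on lattice points, its linear part is a
    primitive vector, because it takes the value 1 at the difference of two
    vertices. Completing it to a unimodular matrix turns the i-th coordinate
    into the last coordinate, and a translation moves the i-th vertex to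
    (0, ..., 0, 1). *)
Lemma pyramid_of_facet d (V : 'M[int]_(d.+2, d.+1)) (i : 'I_d.+2)
    (VR : 'M[R]_(d.+2, d.+1) := map_mx intr V) :
  homog VR \in unitmx ->
  (forall (h : int) (x : 'rV[int]_d.+1), exists m : int,
      bary VR h%:~R (map_mx intr x) 0 i = m%:~R) ->
  lattice_pyramid (hull VR).
Proof.
move=> uV facet.
have [a0 a0E] := facet 1 0.
have /choice[a aE] : forall j, exists m : int,
    bary VR 0 (delta_mx 0 j) 0 i = m%:~R.
  move=> j; have [m] := facet 0 (delta_mx 0 j).
  by rewrite map_delta_mx mulr0z => mE; exists m.
pose ac : 'cV[int]_d.+1 := \col_j a j.
have bE (x : 'rV[int]_d.+1) :
    bary VR 1 (map_mx intr x) 0 i = (a0 + (x *m ac) 0 0)%:~R.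
  rewrite bary_sum_delta.
  rewrite mxE intrD; congr (_ + _); first by rewrite -a0E mulr1z raddf0.
  rewrite summxE mxE rmorph_sum; apply: eq_bigr => j _.
  by rewrite [map_mx _ _ _ _]mxE [LHS]mxE aE mxE rmorphM.
have rowE' k : a0 + (row k V *m ac) 0 0 = (k == i)%:R.
  apply: (intr_inj (R := R)); rewrite -bE map_row bary_row // mxE eqxx [k == i]eq_sym.
  by case: (i == k).
have [U uU Ua] : exists2 U : 'M[int]_d.+1, U \in unitmx & col ord_max U = ac.
  have [l li] := exists_neq_ord i (ltn0Sn d).
  apply: (@primitive_col_completion _ (row i V - row l V)).
  rewrite mulmxBl; apply/matrixP => x y; rewrite !ord1.
  rewrite [LHS]mxE [X in _ + X]mxE [RHS]mxE eqxx mulr1n.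
  have := rowE' i; have := rowE' l; rewrite eqxx eq_sym (negPf li) => e2 e1.
  set p := (_ *m _) 0 0; set q := (row l V *m _) 0 0.
  transitivity ((a0 + p) - (a0 + q)); first by ring.
  by rewrite e1 e2 subr0.
(* The last entry makes the last coordinate equal to t_i, and the others move
   the i-th vertex above the origin. *)
pose w : 'rV[int]_d.+1 :=
  \row_j if j == ord_max then a0 else - (row i V *m U) 0 j.
pose f k := row k V *m U + w.
have f_last k : f k 0 ord_max = (k == i)%:R.
  rewrite -rowE' mxE addrC [w _ _]mxE eqxx; congr (_ + _).
  rewrite -Ua [LHS]mxE [RHS]mxE; apply: eq_bigr => j _.
  by rewrite [col _ _ _ _]mxE.
have f_apex j : f i 0 (lift ord_max j) = 0.
  by rewrite mxE [w _ _]mxE eq_sym (negPf (neq_lift _ _)) subrr.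
pose Y : 'M[int]_(d.+1, d) := \matrix_(k, j) f (lift i k) 0 (lift ord_max j).
pose YR : 'M[R]_(d.+1, d) := map_mx intr Y.
pose W : 'M[R]_(d.+2, d.+1) :=
  VR *m map_mx intr U + const_mx 1 *m map_mx intr w.
have uW : homog W \in unitmx.
  rewrite /W -[VR]scale1r; apply: homog_affine; rewrite ?scale1r ?oner_neq0 //.
  exact: map_intr_unitmx.
have rowW k : row k W = map_mx intr (f k).
  rewrite /f map_mxD map_mxM map_row /W raddfD /= !row_mul; congr (_ + _).
  rewrite -[RHS]mul1mx; congr (_ *m _).
  by apply/matrixP => x y; rewrite !mxE !ord1.
have apexE : append 0 1 = row i W.
  symmetry; apply: eq_append => [|j]; rewrite rowW mxE.
    by rewrite f_last eqxx.
  by rewrite f_apex mxE.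
have baseE l : append (row l YR) 0 = row (lift i l) W.
  symmetry; apply: eq_append => [|j]; rewrite rowW mxE.
    by rewrite f_last eq_sym (negPf (neq_lift _ _)).
  by rewrite !mxE.
(* Coefficients of the base, extended by zero at the apex. *)
pose ext (c : 'rV[R]_d.+1) : 'rV[R]_d.+2 := \row_k oapp (c 0) 0 (unlift i k).
have ext_i c : ext c 0 i = 0 by rewrite mxE unlift_none.
have ext_lift c l : ext c 0 (lift i l) = c 0 l by rewrite mxE liftK.
have sum_ext c : \sum_k ext c 0 k = \sum_k c 0 k.
  rewrite (bigD1_ord i) //= ext_i add0r.
  by apply: eq_bigr => l _; rewrite ext_lift.
have extW c : ext c *m W = append (c *m YR) 0.
  rewrite mulmx_sum_row (bigD1_ord i) //= ext_i scale0r add0r.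
  apply: eq_append => [|j].
    rewrite summxE big1 // => l _.
    by rewrite -baseE mxE append_last mulr0.
  rewrite summxE [RHS]mxE; apply: eq_bigr => l _.
  by rewrite ext_lift -baseE mxE append_lift [row _ _ _ _]mxE.
have uY : homog YR \in unitmx.
  rewrite -row_free_unit; apply: inj_row_free => c cM.
  have [c1 cY] : \sum_i c 0 i = 0 /\ c *m YR = 0.
    by apply: eq_row_mx1; rewrite -mul_ones -mul_homog cM raddf0 row_mx0.
  have : bary W 0 0 = ext c.
    apply/baryE => //; rewrite sum_ext extW cY; split=> //.
    by symmetry; apply: eq_append => *; rewrite !mxE.
  rewrite bary0 => c0; apply/rowP => l.
  by rewrite -ext_lift -c0 !mxE.
exists d, (hull YR), (Pyr (hull YR)); split.
- by apply/lattice_polytope_hull => //; exists Y.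
- exact: homog_unit_dim.
- exact: iterated_Pyr_one.
exists U, w; split; first exact: unitmx_det_pm1.
rewrite affine_hull -/W; apply/seteqP; split=> x.
  case=> n [v [c [vS c0 c1 ->]]]; apply: hull_convex => // k.
  have [[y [e [e0 e1 ->]] <-]|->] := vS k; last by rewrite apexE; apply: row_hull.
  exists (ext e); split; rewrite ?sum_ext ?extW //.
  by move=> l; rewrite mxE; case: unlift.
case=> c [c0 c1 ->]; exists d.+2, (fun k => row k W), (fun k => c 0 k).
split=> //; last exact: mulmx_sum_row.
move=> k; case: (unliftP i k) => [l|] ->.
  by left; exists (row l YR); [exact: row_hull | exact: baseE].
by right; rewrite /= -apexE.
Qed.

(** In a pyramid, the last coordinate is 1 at the apex and 0 at the other
    vertices, hence its sum over all vertices is 1. But this sum is even when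
    the vertices add up to an even vector and their number is even. *)
Lemma pyramid_odd_sum d (V : 'M[int]_(d.+1, d)) (z : 'rV[int]_d)
    (VR : 'M[R]_(d.+1, d) := map_mx intr V) :
  homog VR \in unitmx -> odd d -> const_mx 1 *m V = 2 *: z ->
  ~ lattice_pyramid (hull VR).
Proof.
move=> uV dodd Vz [d0 [P0 [Q [_ _ /iterated_Pyr_inv]]]].
case: d V z @VR uV dodd Vz Q => [//|d] V z VR uV dodd Vz Q.
case=> P -> [U [w [/det_pm1_unit uU]]].
rewrite affine_hull; set W := (X in hull X) => PE.
have uW : homog W \in unitmx.
  rewrite /W -[VR]scale1r; apply: homog_affine; rewrite ?scale1r ?oner_neq0 //.
  exact: map_intr_unitmx.
have rowW k : (exists y, row k W = append y 0) \/ row k W = append 0 1.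
  have : vertex (hull W) (row k W) by apply/vertex_hull => //; exists k.
  rewrite -PE => /vertex_conv_hull[[y _ <-]|->]; last by right.
  by left; exists y.
have [k0 k0W] : exists k, row k W = append 0 1.
  have [c [c0 c1 cW]] : hull W (append 0 1).
    rewrite -PE; exists 1%N, (fun=> append 0 1), (fun=> 1).
    by split=> //; [right | rewrite big_ord1 | rewrite big_ord1 scale1r].
  apply/not_existsP => noapex.
  have := append_last (0 : 'rV[R]_d) 1; rewrite cW mulmx_sum_row summxE big1.
    by move/eqP; rewrite eq_sym oner_eq0.
  move=> k _; have [[y yW]|//] := rowW k.
    by rewrite yW mxE append_last mulr0.
  by move/noapex.
have lastW k : W k ord_max = (k == k0)%:R.
  have rW : W k ord_max = row k W 0 ord_max by rewrite [RHS]mxE.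
  rewrite rW; have [->|kk0] := eqVneq k k0; first by rewrite k0W append_last.
  have [[y ->]|kW] := rowW k; first by rewrite append_last.
  have : delta_mx 0 k0 = delta_mx 0 k :> 'rV[R]_d.+2.
    by rewrite -(bary_row k0 uW) -(bary_row k uW) kW k0W.
  move=> /rowP/(_ k)/eqP kE; exfalso; move: kE.
  by rewrite !mxE !eqxx (negPf kk0) eq_sym oner_eq0.
have : \sum_k W k ord_max = 1.
  rewrite (bigD1 k0) //= lastW eqxx big1 ?addr0 // => k /negPf kk0.
  by rewrite lastW kk0.
have -> : \sum_k W k ord_max = (const_mx 1 *m W : 'rV_d.+1) 0 ord_max.
  by rewrite mxE; apply: eq_bigr => k _; rewrite [X in X * _]mxE mul1r.
pose m := (z *m U) 0 ord_max + (d.+2)./2%:Z * w 0 ord_max.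
have -> : (const_mx 1 *m W : 'rV_d.+1) 0 ord_max = (2 * m)%:~R.
  rewrite /W mulmxDr !mulmxA.
  have -> : const_mx 1 *m VR = map_mx intr (2 *: z) :> 'rV[R]_d.+1.
    by rewrite -Vz map_mxM map_const_mx rmorph1.
  have -> : const_mx 1 *m (const_mx 1 : 'cV[R]_d.+2) = (d.+2)%:R%:M :> 'M[R]_1.
    rewrite mul_ones; congr _%:M.
    by under eq_bigr do rewrite mxE; rewrite sumr_const card_ord.
  rewrite mul_scalar_mx -map_mxM -scalemxAl [LHS]mxE [map_mx _ _ _ _]mxE.
  rewrite [(_ *: (z *m U)) _ _]mxE [(_ *: map_mx _ _) _ _]mxE.
  rewrite [map_mx _ w _ _]mxE /m mulrDr intrD.
  congr (_ + _).
  rewrite !intrM mulrA; congr (_ * _).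
  by rewrite -intrM -PoszM mul2n even_halfK //=; move: dodd => /=; case: odd.
by move/(intr_inj (x2 := 1)); lia.
Qed.

End Pyramid.

(** * Half-integral simplices *)

Lemma map_homog (K L : pzRingType) (f : {rmorphism K -> L}) d (V : 'M[K]_(d.+1, d)) :
  map_mx f (homog V) = homog (map_mx f V).
Proof.
by rewrite /homog; have := @map_row_mx _ _ f d.+1 1 d (const_mx 1) V;
   rewrite map_const_mx rmorph1.
Qed.

Lemma homog_row_perm (K : pzRingType) d (s : 'S_d.+1) (V : 'M[K]_(d.+1, d)) :
  homog (row_perm s V) = row_perm s (homog V).
Proof.
by apply/matrixP => i j; rewrite !mxE; case: fintype.splitP => k _; rewrite !mxE.
Qed.

Lemma homog_mul_block (K : pzRingType) d (V : 'M[K]_(d.+1, d)) (U : 'M[K]_d)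
    (w : 'rV[K]_d) :
  homog (V *m U + const_mx 1 *m w) =
  homog V *m (block_mx 1%:M w 0 U : 'M[K]_(1 + d)).
Proof.
rewrite /homog [RHS](@mul_row_block _ d.+1 1 d 1 d) mulmx1 mulmx0 addr0.
by rewrite addrC.
Qed.

Lemma mulrz2_mxI m n (A B : 'M[int]_(m, n)) : 2 *: A = 2 *: B -> A = B.
Proof.
move=> AB; apply/matrixP => i j; have /matrixP/(_ i j) := AB.
by rewrite !mxE; apply: mulfI.
Qed.

Lemma map_intr_mx_inj (R : realType) m n :
  injective (map_mx intr : 'M[int]_(m, n) -> 'M[R]_(m, n)).
Proof.
move=> A B AB; apply/matrixP => i j; apply: (@intr_inj R).
by have /matrixP/(_ i j) := AB; rewrite !mxE.
Qed.

Lemma map_F2_eq0 m n (A : 'M[int]_(m, n)) :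
  map_mx intr A = 0 :> 'M['F_2]_(m, n) <-> exists B, A = 2 *: B.
Proof.
split=> [A0|[B ->]]; last first.
  apply/matrixP => i j; rewrite !mxE intrM.
  by rewrite (_ : 2%:~R = 0 :> 'F_2) ?mul0r //; apply/val_inj.
exists (map_mx (fun a => (a %/ 2)%Z) A); apply/matrixP => i j.
rewrite !mxE mulrC divzK // (dvdz_pcharf (pchar_Fp (isT : prime 2))).
by have /matrixP/(_ i j) := A0; rewrite !mxE => ->.
Qed.

(** N is twice the inverse of the homogenized matrix, so this says that the
    barycentric coordinates of lattice points are multiples of 1/2. *)
Definition half_integral d (V : 'M[int]_(d.+1, d)) : Prop :=
  exists N : 'M[int]_d.+1, N *m homog V = 2%:M.

(** The left kernel of this matrix is the code of the simplex: a word c is in it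
    if and only if the point with coordinates c / 2 is a lattice point. *)
Definition homog2 d (V : 'M[int]_(d.+1, d)) : 'M['F_2]_d.+1 :=
  homog (map_mx intr V).

Lemma homog2E d (V : 'M[int]_(d.+1, d)) : homog2 V = map_mx intr (homog V).
Proof. by rewrite map_homog. Qed.

Section Characterization.
Variable R : realType.

Lemma mulrn_double_half n r : n = r.*2 -> 2^-1 *+ n = r%:R :> R.
Proof. by move=> ->; rewrite -mul2n -[LHS]mulr_natr natrM mulrA mulVf // mul1r. Qed.

Lemma half_integral_unit d (V : 'M[int]_(d.+1, d)) :
  half_integral V -> homog (map_mx intr V : 'M[R]_(d.+1, d)) \in unitmx.
Proof.
case=> N NV; rewrite -map_homog.
have := congr1 (map_mx (intr : int -> R)) NV; rewrite map_mxM map_scalar_mx /=.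
move=> NVR; suff E : (2^-1 *: map_mx intr N) *m map_mx intr (homog V) = 1%:M :> 'M[R]__.
  by have [] := mulmx1_unit E.
by rewrite -scalemxAl NVR scale_scalar_mx mulVf.
Qed.

(** Over the reals, a left inverse is a right inverse. *)
Lemma half_inverseC d (V : 'M[int]_(d.+1, d)) N :
  N *m homog V = 2%:M -> homog V *m N = 2%:M.
Proof.
move=> NV; apply: (@map_intr_mx_inj R).
have := congr1 (map_mx (intr : int -> R)) NV; rewrite !map_mxM map_scalar_mx /=.
move=> NVR; rewrite -[LHS]scale1r -[X in X *: _](@mulfV _ (2 : R)) // -scalerA.
rewrite scalemxAr (mulmx1C (_ : (2^-1 *: map_mx intr N) *m _ = 1%:M)).
  by rewrite scalemx1.
by rewrite -scalemxAl NVR scale_scalar_mx mulVf.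
Qed.

Lemma bary_half d (V : 'M[int]_(d.+1, d)) N (h : int) (x : 'rV[int]_d) :
  N *m homog V = 2%:M ->
  bary (map_mx intr V : 'M[R]_(d.+1, d)) h%:~R (map_mx intr x) =
  2^-1 *: map_mx intr ((row_mx h%:M x : 'rV_(1 + d)) *m N).
Proof.
move=> NV; have uV : homog (map_mx intr V : 'M[R]_(d.+1, d)) \in unitmx.
  by apply: half_integral_unit; exists N.
rewrite /bary -[RHS](mulmxK uV); congr (_ *m _); symmetry.
rewrite -scalemxAl -map_homog -map_mxM -mulmxA NV mul_mx_scalar map_mxZ.
rewrite scalerA mulVf // scale1r.
by rewrite (@map_row_mx _ _ _ 1 1 d) map_scalar_mx.
Qed.

(** The point z has all coordinates equal to 1/2 at height r. Moving it to the
    origin makes rP reflexive: up to sign, the polar vertices are the columns of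
    twice the inverse of the homogenized matrix, without their first entry. *)
Lemma half_integral_gorenstein d r (V : 'M[int]_(d.+1, d)) (z : 'rV[int]_d)
    (VR : 'M[R]_(d.+1, d) := map_mx intr V) :
  (0 < r)%N -> d.+1 = r.*2 -> half_integral V -> const_mx 1 *m V = 2 *: z ->
  gorenstein (hull VR) /\ codeg (hull VR) = r.
Proof.
move=> r0 dr hV zE; have uV : homog VR \in unitmx by apply: half_integral_unit.
have r0R : r%:R != 0 :> R by rewrite pnatr_eq0 -lt0n.
have [N NV] := hV.
have bz : bary VR r%:R (map_mx intr z) = const_mx 2^-1.
  apply/baryE => //; split.
    rewrite (eq_bigr (fun=> 2^-1)); last by move=> i _; rewrite mxE.
    by rewrite sumr_const card_ord; exact: mulrn_double_half.
  rewrite -[2^-1]mulr1 -scalemx_const -scalemxAl.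
  have -> : const_mx 1 *m VR = map_mx intr (const_mx 1 *m V) :> 'rV[R]_d.
    by rewrite map_mxM map_const_mx rmorph1.
  by rewrite zE map_mxZ scalerA mulVf // scale1r.
have bpos (m : nat) (y : 'rV[int]_d) i :
    0 < bary VR m%:R (map_mx intr y) 0 i -> 2^-1 <= bary VR m%:R (map_mx intr y) 0 i.
  rewrite [m%:R]pmulrn (bary_half m y NV) !mxE pmulr_rgt0 ?invr_gt0 // ltr0z.
  by move=> k0; rewrite -[X in X <= _]mulr1 ler_pM2l ?invr_gt0 // ler1z.
split; last first.
  apply: (codeg_eq uV r0 (z := z)) => [i|m y m0 my].
    by rewrite bz mxE invr_gt0.
  rewrite -(ler_nat R) -(sum_bary r%:R (map_mx intr z) uV).
  rewrite -(sum_bary m%:R (map_mx intr y) uV) ler_sum // => i _.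
  by rewrite bz mxE bpos.
split; [|exact: homog_unit_dim|].
  by apply/lattice_polytope_hull => //; exists V.
exists r; split=> //; pose w := - z.
pose W := (r%:R *: VR) *m map_mx intr (1%:M : 'M[int]_d) + const_mx 1 *m map_mx intr w.
exists (hull W); split.
  exists 1%:M, w; split; first by left; rewrite det1.
  by rewrite dilate_hull affine_hull.
have u1 : map_mx intr (1%:M : 'M[int]_d) \in @unitmx R d.
  by apply: map_intr_unitmx; exact: unitmx1.
have uW : homog W \in unitmx by apply: homog_affine.
have bW (h : R) y : bary W h (y + h *: map_mx intr w) = r%:R^-1 *: bary VR (h * r%:R) y.
  have := bary_affine (map_mx intr w) y h uV r0R u1.
  by rewrite -/W map_mx1 mulmx1.
have b0 i : bary W 1 0 0 i = r%:R^-1 / 2.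
  have := bW 1 (map_mx intr z); rewrite scale1r mul1r bz -map_mxD subrr.
  by rewrite raddf0 => ->; rewrite !mxE.
have W0 i : 0 < bary W 1 0 0 i by rewrite b0 mulr_gt0 ?invr_gt0 // ltr0n.
split.
- apply/lattice_polytope_hull => //.
  exists (r%:R *: V + const_mx 1 *m w).
  by rewrite map_mxD map_mxM map_mxZ map_const_mx rmorph1 rmorph_nat /W map_mx1 mulmx1.
- exact: homog_unit_dim.
- have := interiorE 0 uW (isT : (0 < 1)%N); rewrite dilate_hull scale1r => intW.
  by apply/intW.
- apply/lattice_polar => //.
  exists (\matrix_(i, j) - ((row_mx 0%:M (delta_mx 0 j) : 'rV[int]_(1 + d)) *m N) 0 i).
  apply/matrixP => i j; rewrite [LHS]mxE b0.
  have := bW 0 (delta_mx 0 j); rewrite scale0r addr0 mul0r => ->.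
  have := bary_half 0 (delta_mx 0 j) NV; rewrite mulr0z map_delta_mx => ->.
  rewrite [in LHS]mxE [X in _ * (_ * X) = _]mxE [RHS]mxE [X in _ = X%:~R]mxE.
  by rewrite [X in _ * (_ * (_ * X))]mxE raddfN /=; field.
Qed.

End Characterization.

(** * Unimodular equivalence and codes *)

Section Equivalence.
Variable R : realType.

(** The d + 1 unit fractions 1/b_i are at most 1/2 each and add up to
    r = (d + 1)/2. *)
Lemma gorenstein_half_integral d r (V : 'M[int]_(d.+1, d))
    (VR : 'M[R]_(d.+1, d) := map_mx intr V) :
  homog VR \in unitmx -> (0 < r)%N -> d.+1 = r.*2 ->
  gorenstein (hull VR) -> codeg (hull VR) = r -> ~ lattice_pyramid (hull VR) ->
  half_integral V /\ exists z : 'rV[int]_d, const_mx 1 *m V = 2 *: z.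
Proof.
move=> uV r0 dr gor cr nopyr.
have d0 : (0 < d)%N by rewrite -ltnS dr -(doubleS 0) leq_double.
have [z [b [b0 bz bx]]] := gorenstein_unit_fractions uV d0 gor.
have b2 i : (2 <= b i)%N.
  rewrite ltn_neqAle b0 andbT; apply/eqP => b1; apply: nopyr.
  case: d V @VR uV dr gor cr d0 z b b0 bz bx i b1 => // d V VR uV _ _ _ _ z b _ _ bx i b1.
  apply: (pyramid_of_facet (i := i)) => // h x.
  by have [m ->] := bx i h x; exists m; rewrite -b1 divr1.
have {}b2 i : (b i)%:R^-1 = 2^-1 :> R.
  have ge0 j : 0 <= 2^-1 - (b j)%:R^-1 :> R.
    by rewrite subr_ge0 lef_pV2 ?posrE ?ltr0n // ler_nat.
  have : \sum_i (2^-1 - (b i)%:R^-1) = 0 :> R.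
    rewrite sumrB sumr_const card_ord (mulrn_double_half R dr).
    rewrite -[X in X - _](sum_bary _ (map_mx intr z) uV).
    apply/eqP; rewrite subr_eq0; apply/eqP; apply: eq_bigr => j _.
    by rewrite -bz cr.
  move/eqP; rewrite psumr_eq0 // => /allP /(_ i (mem_index_enum _)) /=.
  by rewrite subr_eq0 => /eqP.
split.
  have /choice[n nE] : forall p : 'I_d.+1 * 'I_d.+1, exists m : int,
      invmx (homog VR) p.1 p.2 = m%:~R / 2.
    case=> j i /=.
    pose w : 'rV[int]_(1 + d) := delta_mx 0 j.
    have [m] := bx i (w 0 (lshift d 0)) (rsubmx w); rewrite b2 => mE.
    exists m; rewrite -mE /bary.
    have -> : row_mx (w 0 (lshift d 0))%:~R%:M (map_mx intr (rsubmx w)) =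
        delta_mx 0 j :> 'rV[R]_(1 + d).
      rewrite -map_scalar_mx -(@map_row_mx _ _ _ 1 1 d).
      have -> : (w 0 (lshift d 0))%:M = lsubmx w.
        by apply/matrixP => x y; rewrite !ord1 !mxE eqxx mulr1n.
      by rewrite hsubmxK map_delta_mx.
    by rewrite -rowE mxE.
  exists (\matrix_(j, i) n (j, i)); apply: (@map_intr_mx_inj R).
  rewrite map_mxM map_homog map_scalar_mx /=.
  rewrite (_ : map_mx _ _ = 2 *: invmx (homog VR)); last first.
    by apply/matrixP => j i; rewrite !mxE (nE (j, i)) mulrC divfK.
  by rewrite -scalemxAl mulVmx // scalemx1.
exists z; apply: (@map_intr_mx_inj R).
rewrite map_mxM map_const_mx rmorph1 map_mxZ.
rewrite -(bary_mul r%:R (map_mx intr z) uV).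
rewrite (_ : bary _ _ _ = const_mx 2^-1).
  by rewrite rmorph_nat scalemxAl scalemx_const mulfV.
by apply/rowP => i; rewrite -[in LHS]cr bz b2 mxE.
Qed.

Lemma unimod_equiv_hull d (V : 'M[int]_(d.+1, d)) (U : 'M[int]_d) (w : 'rV[int]_d) :
  U \in unitmx ->
  unimod_equiv (hull (map_mx intr V : 'M[R]_(d.+1, d)))
    (hull (map_mx intr (V *m U + const_mx 1 *m w))).
Proof.
move=> uU; exists U, w; split; first exact: unitmx_det_pm1.
by rewrite affine_hull map_mxD !map_mxM map_const_mx rmorph1.
Qed.

(** An affine isomorphism maps vertices to vertices. *)
Lemma unimod_equiv_rows d (V V' : 'M[int]_(d.+1, d)) :
  homog (map_mx intr V : 'M[R]_(d.+1, d)) \in unitmx ->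
  homog (map_mx intr V' : 'M[R]_(d.+1, d)) \in unitmx ->
  unimod_equiv (hull (map_mx intr V : 'M[R]_(d.+1, d))) (hull (map_mx intr V')) ->
  exists (s : 'S_d.+1) (U : 'M[int]_d) (w : 'rV[int]_d),
    U \in unitmx /\ V' = row_perm s (V *m U + const_mx 1 *m w).
Proof.
move=> uV uV' [U [w [/det_pm1_unit uU]]]; rewrite affine_hull.
set W := (X in _ = hull X) => VW.
have WE : W = map_mx intr (V *m U + const_mx 1 *m w).
  by rewrite /W map_mxD !map_mxM map_const_mx rmorph1.
have uW : homog W \in unitmx.
  rewrite /W -[map_mx intr V]scale1r; apply: homog_affine; rewrite ?oner_neq0 //.
  exact: map_intr_unitmx.
have /choice[f fE] : forall i, exists j, row i (map_mx intr V') = row j W.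
  move=> i; apply/(vertex_hull _ uW); rewrite -VW.
  by apply/vertex_hull => //; exists i.
have finj : injective f.
  move=> i j ij; have ri : row i (map_mx intr V') = row j (map_mx intr V') :> 'rV[R]_d.
    by rewrite !fE ij.
  have : delta_mx 0 i = delta_mx 0 j :> 'rV[R]_d.+1.
    by rewrite -(bary_row i uV') ri bary_row.
  move=> /rowP /(_ i); rewrite !mxE !eqxx /=; case: eqVneq => // _ /eqP.
  by rewrite oner_eq0.
exists (perm finj), U, w; split=> //; apply: (@map_intr_mx_inj R).
rewrite map_row_perm -WE; apply/row_matrixP => i; rewrite fE.
by apply/rowP => j; rewrite !mxE permE.
Qed.

Lemma code_unimod d (V : 'M[int]_(d.+1, d)) (s : 'S_d.+1) (U : 'M[int]_d)
    (w : 'rV[int]_d) (c : 'rV['F_2]_d.+1) : U \in unitmx ->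
  (col_perm s c *m homog2 (row_perm s (V *m U + const_mx 1 *m w)) == 0) =
  (c *m homog2 V == 0).
Proof.
move=> uU; rewrite !homog2E homog_row_perm map_row_perm mul_row_perm.
have -> : col_perm s^-1 (col_perm s c) = c.
  by apply/rowP => i; rewrite !mxE permKV.
rewrite homog_mul_block map_mxM mulmxA.
set x := c *m _; set T := (X in x *m X).
have uT : T \in unitmx.
  rewrite unitmxE det_map_mx; apply: rmorph_unit.
  by rewrite (@det_ublock _ 1 d) det1 mul1r -unitmxE.
by apply/eqP/eqP => [xT|->]; [rewrite -[x](mulmxK uT) xT mul0mx | rewrite mul0mx].
Qed.

Lemma unimod_equiv_code d (V V' : 'M[int]_(d.+1, d)) :
  homog (map_mx intr V : 'M[R]_(d.+1, d)) \in unitmx ->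
  homog (map_mx intr V' : 'M[R]_(d.+1, d)) \in unitmx ->
  unimod_equiv (hull (map_mx intr V : 'M[R]_(d.+1, d))) (hull (map_mx intr V')) ->
  exists s : 'S_d.+1, forall c : 'rV['F_2]_d.+1,
    (col_perm s c *m homog2 V' == 0) = (c *m homog2 V == 0).
Proof.
move=> uV uV' /(unimod_equiv_rows uV uV')[s [U [w [uU ->]]]].
by exists s => c; apply: code_unimod.
Qed.

(** The rows of N modulo 2 are words of the code of V. If they are in the code
    of V' too, N (1, V') is divisible by 2, that is, the base change from V to
    V' is integral. *)
Lemma same_code_change d (V V' : 'M[int]_(d.+1, d)) (N : 'M[int]_d.+1) :
  N *m homog V = 2%:M ->
  (forall c : 'rV['F_2]_d.+1, c *m homog2 V = 0 -> c *m homog2 V' = 0) ->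
  exists T : 'M[int]_d.+1, N *m homog V' = 2 *: T /\ homog V *m T = homog V'.
Proof.
move=> NV code; have [T TE] : exists T, N *m homog V' = 2 *: T.
  apply/map_F2_eq0; rewrite map_mxM -homog2E; apply/row_matrixP => i.
  rewrite row_mul row0; apply: code; rewrite homog2E -map_row -map_mxM -row_mul NV.
  apply/map_F2_eq0; exists (row i 1%:M).
  by apply/rowP => j; rewrite !mxE mulr_natr.
exists T; split=> //; apply: mulrz2_mxI; rewrite scalemxAr -TE mulmxA.
by rewrite (half_inverseC R NV) mul_scalar_mx.
Qed.

(** After reordering the vertices the codes coincide, so the base changes in
    both directions are integral. They fix the column of heights, hence they
    come from affine unimodular maps. *)
Lemma code_unimod_equiv d (V V' : 'M[int]_(d.+1, d)) (s : 'S_d.+1) :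
  half_integral V -> half_integral V' ->
  (forall c : 'rV['F_2]_d.+1,
    (col_perm s c *m homog2 V' == 0) = (c *m homog2 V == 0)) ->
  unimod_equiv (hull (map_mx intr V : 'M[R]_(d.+1, d))) (hull (map_mx intr V')).
Proof.
move=> [N NV] [N' NV'] code.
pose V'' := row_perm s^-1 V'.
have N''V : col_perm s^-1 N' *m homog V'' = 2%:M.
  rewrite homog_row_perm mul_row_perm invgK -[RHS]NV'; congr (_ *m _).
  by apply/matrixP => i j; rewrite !mxE permK.
have code'' (c : 'rV['F_2]_d.+1) :
    c *m homog2 V'' = col_perm s c *m homog2 V'.
  by rewrite mul_col_perm !homog2E homog_row_perm map_row_perm.
have [T [NT VT]] : exists T, N *m homog V'' = 2 *: T /\ homog V *m T = homog V''.
  by apply: same_code_change => // c /eqP; rewrite -code -code'' => /eqP.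
have [T' [_ VT']] : exists T, col_perm s^-1 N' *m homog V = 2 *: T
    /\ homog V'' *m T = homog V.
  by apply: same_code_change => // c; rewrite code'' => /eqP; rewrite code => /eqP.
have TT' : T *m T' = 1%:M.
  apply: mulrz2_mxI; rewrite scalemxAl -NT -mulmxA VT' NV.
  by rewrite -[RHS]mul_scalar_mx mulmx1.
have [uT _] := mulmx1_unit TT'.
(* The first column of both homogenized matrices is constant equal to 1. *)
have T1 : T *m (delta_mx 0 0 : 'cV_d.+1) = delta_mx 0 0.
  apply: mulrz2_mxI; rewrite scalemxAl -NT -mulmxA.
  have E (W : 'M[int]_(d.+1, d)) : homog W *m (delta_mx 0 0 : 'cV_d.+1) = const_mx 1.
    rewrite -colE; apply/colP => i; rewrite mxE.
    have -> : 0 = lshift d (0 : 'I_1) :> 'I_(1 + d) by apply/val_inj.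
    by rewrite (@row_mxEl _ d.+1 1 d) !mxE.
  by rewrite E -(E V) mulmxA NV mul_scalar_mx.
pose U : 'M[int]_d := @drsubmx _ 1 d 1 d T.
pose w : 'rV[int]_d := @ursubmx _ 1 d 1 d T.
have TE : T = block_mx 1%:M w 0 U :> 'M[int]_(1 + d).
  rewrite -[LHS](@submxK _ 1 d 1 d); congr (block_mx _ _ _ _).
    apply/matrixP => i j; rewrite !ord1 !mxE eqxx.
    have /matrixP/(_ 0 0) := T1; rewrite -colE !mxE eqxx /= mulr1n => <-.
    by congr (T _ _); apply/val_inj.
  apply/matrixP => i j; rewrite !ord1 !mxE.
  have /matrixP/(_ (rshift 1 i) 0) := T1; rewrite -colE !mxE /= => E; rewrite -[RHS]E.
  by congr (T _ _); apply/val_inj.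
have uU : U \in unitmx.
  by move: uT; rewrite TE unitmxE (@det_ublock _ 1 d) det1 mul1r.
have VE : V'' = V *m U + const_mx 1 *m w.
  have : homog V'' = homog (V *m U + const_mx 1 *m w).
    by rewrite homog_mul_block -TE VT.
  by move=> E; have [_ ->] := @eq_row_mx _ d.+1 1 d _ _ _ _ E.
have -> : hull (map_mx intr V' : 'M[R]_(d.+1, d)) = hull (map_mx intr V'').
  by rewrite map_row_perm hull_row_perm.
by rewrite VE; apply: unimod_equiv_hull.
Qed.

Lemma unimod_equiv_refl d (P : set 'rV[R]_d) : unimod_equiv P P.
Proof.
exists 1%:M, 0; split; first by left; rewrite det1.
rewrite map_mx1 raddf0; apply/seteqP; split=> x.
  by move=> Px; exists x; rewrite // mulmx1 addr0.
by case=> y Py <-; rewrite mulmx1 addr0.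
Qed.

Lemma unimod_equiv_sym d (P Q : set 'rV[R]_d) : unimod_equiv P Q -> unimod_equiv Q P.
Proof.
case=> U [w [/det_pm1_unit uU ->]].
exists (invmx U), (- w *m invmx U); split.
  by apply: unitmx_det_pm1; rewrite unitmx_inv.
have E (x : 'rV[R]_d) : (x *m map_mx intr U + map_mx intr w) *m map_mx intr (invmx U) +
    map_mx intr (- w *m invmx U) = x.
  rewrite mulmxDl -mulmxA -map_mxM mulmxV // map_mx1 mulmx1 -addrA -map_mxM.
  by rewrite -map_mxD -mulmxDl subrr mul0mx raddf0 addr0.
apply/seteqP; split=> x.
  by move=> Px; exists (x *m map_mx intr U + map_mx intr w); [exists x | exact: E].
by case=> _ [y Py <-] <-; rewrite E.
Qed.

Lemma unimod_equiv_trans d (P Q S : set 'rV[R]_d) :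
  unimod_equiv P Q -> unimod_equiv Q S -> unimod_equiv P S.
Proof.
case=> U [w [/det_pm1_unit uU ->]] [U' [w' [/det_pm1_unit uU' ->]]].
exists (U *m U'), (w *m U' + w'); split.
  by apply: unitmx_det_pm1; rewrite unitmx_mul uU.
have E (x : 'rV[R]_d) : (x *m map_mx intr U + map_mx intr w) *m map_mx intr U' +
    map_mx intr w' = x *m map_mx intr (U *m U') + map_mx intr (w *m U' + w').
  by rewrite mulmxDl -mulmxA map_mxD !map_mxM addrA.
apply/seteqP; split=> x.
  by case=> _ [y Py <-] <-; exists y; rewrite ?E.
by case=> y Py <-; exists (y *m map_mx intr U + map_mx intr w); [exists y | exact: E].
Qed.

Lemma eq_unimod_class d (P Q : set 'rV[R]_d) :
  unimod_class P = unimod_class Q <-> unimod_equiv P Q.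
Proof.
split=> [PQ|PQ].
  have : unimod_class Q Q by exact: unimod_equiv_refl.
  by rewrite -PQ.
apply/seteqP; split=> S; last exact: unimod_equiv_trans.
by apply: unimod_equiv_trans; apply: unimod_equiv_sym.
Qed.

End Equivalence.

(** * The simplices of the nineteen codes *)

Definition rowb (c : bitseq) : 'rV['F_2]_8 := \row_i (nth false c i)%:R.

Lemma F2_addxx (x : 'F_2) : x + x = 0.
Proof. by rewrite -mulr2n -mulr_natr (pchar_Zp (isT : (1 < 2)%N)) mulr0. Qed.

Lemma F2_add_eq0 (x y : 'F_2) : (x + y == 0) = (x == y).
Proof. by rewrite addr_eq0 -[- y]addr0 -(F2_addxx y) addKr. Qed.

Lemma F2_natr_eq0 n : (n%:R == 0 :> 'F_2) = ~~ odd n.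
Proof. by rewrite -(dvdn_pcharf (pchar_Fp (isT : prime 2))) dvdn2. Qed.

Lemma rowb_addw x y : size x = size y -> rowb (addw x y) = rowb x + rowb y.
Proof.
move=> sxy; apply/rowP => i; rewrite !mxE nth_addw //.
by case: (nth _ x i) (nth _ y i) => -[]; rewrite ?addr0 ?add0r ?F2_addxx.
Qed.

Lemma rowb_nil : rowb [::] = 0.
Proof. by apply/rowP => i; rewrite !mxE nth_nil. Qed.

Lemma rowb_zero : rowb zerow = 0.
Proof. by apply/rowP => i; rewrite !mxE nth_nseq; case: ifP. Qed.

Lemma rowb_ones : rowb (nseq 8 true) = const_mx 1.
Proof. by apply/rowP => i; rewrite !mxE nth_nseq ltn_ord. Qed.

Lemma rowb_inj x y : size x = 8 -> size y = 8 -> rowb x = rowb y -> x = y.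
Proof.
move=> sx sy xy; apply: (@eq_from_nth _ false); rewrite sx // => i i8.
have /rowP/(_ (Ordinal i8)) := xy; rewrite !mxE /=.
by case: (nth _ x i) (nth _ y i) => -[] // /eqP.
Qed.

Lemma rowb_surj (v : 'rV['F_2]_8) : exists2 c, size c = 8 & rowb c = v.
Proof.
exists (mkseq (fun i => v 0 (inord i) != 0) 8); first exact: size_mkseq.
apply/rowP => i; rewrite mxE nth_mkseq // inord_val.
by case: (v 0 i) => -[|[|]] // k; apply/val_inj.
Qed.

Lemma sum_rowb c : size c = 8 -> \sum_i rowb c 0 i = (weight c)%:R.
Proof.
move=> sc; rewrite /weight -sum1_count (big_nth false) sc big_mkord natr_sum.
rewrite [RHS]big_mkcond /=; apply: eq_bigr => i _; rewrite mxE.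
by case: nth.
Qed.

(** The bound n may exceed the number of generators: the missing ones are read
    as the zero word. *)
Lemma rowb_comb n (G : seq bitseq) m :
  (size G <= n)%N -> (forall g, g \in G -> size g = 8) ->
  rowb (comb G m) = \sum_(i < n) (nth false m i)%:R *: rowb (nth [::] G i).
Proof.
elim: G m n => [|g G IHG] m n sG G8.
  rewrite /comb mask0 rowb_zero big1 // => i _.
  by rewrite nth_nil rowb_nil scaler0.
case: n sG => // n sG; case: m => [|b m].
  by rewrite /comb mask0s rowb_zero big1 // => i _; rewrite nth_nil scale0r.
have G8' h : h \in G -> size h = 8 by move=> hG; apply: G8; rewrite in_cons hG orbT.
rewrite big_ord_recl /= -(IHG m n sG G8').
case: b; rewrite /comb /= ?scale1r ?scale0r ?add0r //.
by rewrite rowb_addw // -/(comb G m) size_comb // G8 ?mem_head.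
Qed.

Definition gen_mx (G : seq bitseq) : 'M[int]_7 :=
  \matrix_(i, j) (nth false (nth [::] G i) j.+1 : nat)%:R.

(** The vertices are the origin and the points e_i + g_i, where g_i is the i-th
    generator without its coordinate 0, or zero when there are at most i
    generators. *)
Definition code_vertices (G : seq bitseq) : 'M[int]_(8, 7) :=
  col_mx (0 : 'rV_7) (1%:M + gen_mx G).

Lemma homog2_mul_eq0 (V : 'M[int]_(8, 7)) (c : 'rV['F_2]_8) :
  (c *m homog2 V == 0) = (\sum_i c 0 i == 0) && (c *m map_mx intr V == 0).
Proof.
rewrite /homog2 mul_homog mul_ones; apply/eqP/andP => [E|[/eqP -> /eqP ->]].
  have [-> ->] : \sum_i c 0 i = 0 /\ c *m map_mx intr V = 0.
    by apply: eq_row_mx1; rewrite E raddf0 row_mx0.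
  by [].
by rewrite raddf0 row_mx0.
Qed.

Lemma mul_code_vertices G (c : bitseq) j :
  (rowb c *m map_mx intr (code_vertices G)) 0 j =
  rowb c 0 (lift ord0 j) +
  \sum_(i < 7) (nth false (behead c) i)%:R * rowb (nth [::] G i) 0 (lift ord0 j).
Proof.
rewrite mxE big_ord_recl [X in X + _](_ : _ = 0); last first.
  have -> : ord0 = lshift 7 (0 : 'I_1) by apply/val_inj.
  rewrite [X in _ * X]mxE /code_vertices (@col_mxEu _ 1 7) [X in X%:~R]mxE.
  by rewrite mulr0z mulr0.
rewrite add0r [X in X + _](_ : _ = \sum_(i < 7) rowb c 0 (lift ord0 i) * (i == j)%:R).
  rewrite -big_split; apply: eq_bigr => i _ /=.
  have {2}-> : lift ord0 i = rshift 1 i by apply/val_inj.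
  rewrite [X in _ * X]mxE /code_vertices (@col_mxEd _ 1 7) !mxE nth_behead.
  by rewrite rmorphD mulrDr /= !rmorph_nat; congr (_ + _ * _); case: nth.
rewrite (bigD1 j) //= eqxx mulr1 big1 ?addr0 // => i /negPf ->.
by rewrite mulr0.
Qed.

(** Writing c = (c_0, c') and A for the matrix of the g_i, the word c is in the
    kernel if and only if c' = c' A and c has even weight. The first condition
    says that c agrees with a word of the code outside coordinate 0, and
    since the generators are even the second one settles this coordinate. *)
Lemma code_vertices_code G c : G \in codes -> size c = 8 ->
  (rowb c *m homog2 (code_vertices G) == 0) = in_code G c.
Proof.
move=> Gc sc; have G8 g := @codes_size G g Gc.
have /and3P[G7 _ /allP Geven] := allP codes_wf G Gc.
rewrite homog2_mul_eq0 in_codeE //.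
have combE l : rowb (comb G (behead c)) 0 l =
    \sum_(i < 7) (nth false (behead c) i)%:R * rowb (nth [::] G i) 0 l.
  rewrite (rowb_comb _ G7 G8) summxE; apply: eq_bigr => i _.
  by rewrite mxE.
have comb_even : \sum_l rowb (comb G (behead c)) 0 l = 0.
  rewrite (eq_bigr _ (fun l _ => combE l)) exchange_big big1 //= => i _.
  rewrite -mulr_sumr; have [iG|iG] := ltnP i (size G); last first.
    by rewrite (nth_default [::] iG) rowb_nil big1 ?mulr0 // => l _; rewrite mxE.
  have /Geven/andP[/eqP g8] := mem_nth [::] iG.
  by rewrite sum_rowb // -F2_natr_eq0 => /eqP ->; rewrite mulr0.
have E : (rowb c *m map_mx intr (code_vertices G) == 0) =
    [forall j : 'I_7, rowb c 0 (lift ord0 j) == rowb (comb G (behead c)) 0 (lift ord0 j)].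
  apply/eqP/forallP => [/rowP E j|E].
    by have := E j; rewrite mul_code_vertices -combE [RHS]mxE => /eqP; rewrite F2_add_eq0.
  apply/rowP => j; rewrite mul_code_vertices -combE [RHS]mxE; apply/eqP.
  by rewrite F2_add_eq0.
rewrite E; apply/andP/eqP => [[/eqP c0 /forallP cE]|cE]; last first.
  rewrite [in X in X == 0]cE comb_even eqxx; split=> //.
  by apply/forallP => j; rewrite -cE.
apply: rowb_inj; rewrite ?size_comb //; apply/rowP => l.
case: (unliftP ord0 l) => [j|] ->; first exact/eqP.
move: c0 comb_even; rewrite big_ord_recl [X in _ -> X = _ -> _]big_ord_recl.
move=> c0 d0; apply: (addIr (\sum_(i < 7) rowb c 0 (lift ord0 i))).
apply: (etrans c0); apply: (etrans (esym d0)).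
by congr (_ + _); apply: eq_bigr => j _; apply/esym/eqP.
Qed.

(** As A is idempotent, (2 - A) (1 + A) = 2. *)
Lemma code_vertices_half_integral G : G \in codes -> half_integral (code_vertices G).
Proof.
move=> Gc; set A := gen_mx G.
have AA : A *m A = A.
  apply/matrixP => i j; rewrite !mxE.
  have /allP/(_ i) := allP codes_idem G Gc; rewrite mem_iota ltn_ord => /(_ isT).
  move=> /allP/(_ j); rewrite mem_iota ltn_ord => /(_ isT)/eqP <-.
  rewrite -sum1_count -[iota 0 7]/(index_iota 0 7) big_mkord natr_sum.
  rewrite [RHS]big_mkcond /=.
  apply: eq_bigr => l _; rewrite !mxE.
  by case: nth; case: nth.
have homE : homog (code_vertices G) =
    (block_mx 1%:M 0 (const_mx 1) (1%:M + A) : 'M[int]_(1 + 7)).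
  rewrite /homog (@block_mxEh _ 1 7 1 7).
  have -> : const_mx 1 = col_mx 1%:M (const_mx 1) :> 'cV[int]_(1 + 7).
    rewrite -[LHS](@vsubmxK _ 1 7); congr col_mx; apply/matrixP => i j;
    by rewrite ?ord1 !mxE ?eqxx.
  by [].
exists (block_mx 2%:M 0 (- (2%:M - A) *m const_mx 1) (2%:M - A) : 'M[int]_(1 + 7)).
rewrite homE [LHS](@mulmx_block _ 1 7 1 7 1 7) !mulmx0 !mul0mx !mulmx1 !addr0 add0r.
rewrite mulNmx addNr mulmxDr mulmx1 mulmxBl AA mul_scalar_mx.
rewrite (_ : 2%:M - A + (2 *: A - A) = 2%:M); last first.
  by rewrite scaler_nat mulr2n addrK subrK.
by rewrite -(@scalar_mx_block _ 1 7).
Qed.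

Lemma code_vertices_sum_even G : G \in codes ->
  exists z : 'rV[int]_7, const_mx 1 *m code_vertices G = 2 *: z.
Proof.
move=> Gc; have /and3P[_ ones _] := allP codes_wf G Gc.
have := code_vertices_code Gc (erefl : size (nseq 8 true) = 8).
rewrite ones homog2_mul_eq0 rowb_ones => /andP[_ /eqP V0].
by apply/map_F2_eq0; rewrite map_mxM map_const_mx rmorph1.
Qed.

Lemma simplex_even_code_with_ones (V : 'M[int]_(8, 7)) (z : 'rV[int]_7) :
  const_mx 1 *m V = 2 *: z -> even_code_with_ones (fun c => rowb c *m homog2 V == 0).
Proof.
move=> Vz; split.
- by rewrite rowb_zero mul0mx.
- rewrite rowb_ones homog2_mul_eq0; apply/andP; split.
    by under eq_bigr do rewrite mxE; rewrite sumr_const card_ord F2_natr_eq0.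
  apply/eqP; have /map_F2_eq0 := ex_intro (fun z => const_mx 1 *m V = 2 *: z) z Vz.
  by rewrite map_mxM map_const_mx rmorph1.
- move=> x y sx sy /eqP x0 /eqP y0.
  by rewrite rowb_addw ?sx ?sy // mulmxDl x0 y0 addr0.
- move=> x sx; rewrite homog2_mul_eq0 => /andP[+ _].
  by rewrite sum_rowb // F2_natr_eq0.
Qed.

Lemma act_perm p : perm_eq p (iota 0 8) ->
  exists s : 'S_8, forall c, rowb (act p c) = col_perm s (rowb c).
Proof.
move=> pP; have sp : size p = 8 by rewrite (perm_size pP).
have p8 (i : 'I_8) : (nth 0%N p i < 8)%N.
  have : nth 0%N p i \in p by rewrite mem_nth ?sp.
  by rewrite (perm_mem pP) mem_iota.
have inj : injective (fun i => Ordinal (p8 i)).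
  move=> i j [] /eqP; rewrite nth_uniq ?sp // ?(perm_uniq pP) ?iota_uniq //.
  by move/eqP/val_inj.
exists (perm inj) => c; apply/rowP => i; rewrite !mxE permE.
by rewrite (nth_map 0%N) ?sp.
Qed.

Lemma perm_act (s : 'S_8) : exists2 p, perm_eq p (iota 0 8) &
  forall c, rowb (act p c) = col_perm s (rowb c).
Proof.
exists [seq val (s i) | i <- enum 'I_8].
  rewrite -val_enum_ord (map_comp val s) perm_map //.
  apply: uniq_perm; rewrite ?(map_inj_uniq (@perm_inj _ s)) ?enum_uniq // => i.
  rewrite mem_enum; apply/mapP; by exists (s^-1%g i); rewrite ?mem_enum ?permKV.
move=> c; apply/rowP => i; rewrite !mxE (nth_map 0%N); last first.
  by rewrite size_map size_enum_ord.
by rewrite (nth_map ord0) ?size_enum_ord // nth_ord_enum.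
Qed.

Definition code_simplex (R : realType) (G : seq bitseq) : set 'rV[R]_7 :=
  hull (map_mx intr (code_vertices G)).
Arguments code_simplex : clear implicits.

Section Main.
Variable R : realType.

Lemma code_vertices_unit G : G \in codes ->
  homog (map_mx intr (code_vertices G) : 'M[R]_(8, 7)) \in unitmx.
Proof. by move=> Gc; apply/half_integral_unit/code_vertices_half_integral. Qed.

Lemma degree_eq4 (P : set 'rV[R]_7) : degree P = 4 <-> codeg P = 4%N.
Proof. by rewrite /degree; split; lia. Qed.

Lemma code_simplex_gorenstein_degree4 G : G \in codes ->
  [/\ gorenstein_simplex (code_simplex R G), has_dim (code_simplex R G) 7,
      degree (code_simplex R G) = 4 & ~ lattice_pyramid (code_simplex R G)].
Proof.
move=> Gc; have uV := code_vertices_unit Gc.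
have [z Vz] := code_vertices_sum_even Gc.
have [gor cod] := half_integral_gorenstein R (isT : (0 < 4)%N) erefl
  (code_vertices_half_integral Gc) Vz.
split.
- by split=> //; exact: homog_unit_simplex.
- exact: homog_unit_dim.
- exact/degree_eq4.
- exact: pyramid_odd_sum Vz.
Qed.

(** The code of P is one of the nineteen up to permutation, and the code
    determines the simplex. *)
Lemma gorenstein_degree4_code (P : set 'rV[R]_7) :
  [/\ gorenstein_simplex P, has_dim P 7, degree P = 4 & ~ lattice_pyramid P] ->
  exists2 G, G \in codes & unimod_equiv P (code_simplex R G).
Proof.
case=> -[simP gorP] dimP /degree_eq4 codP nopyr.
have [VR uVR PE] := simplex_homog simP dimP; rewrite {}PE in simP gorP dimP codP nopyr *.
have [V VE] : exists V : 'M[int]_(8, 7), VR = map_mx intr V.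
  by case: gorP => + _ _; move/(lattice_polytope_hull uVR).
rewrite {}VE in uVR simP gorP dimP codP nopyr *.
have [hV [z Vz]] := gorenstein_half_integral uVR (isT : (0 < 4)%N) erefl gorP codP nopyr.
have [G [p [Gc pP CG]]] := code_classification (simplex_even_code_with_ones Vz).
exists G => //; apply: unimod_equiv_sym.
have [s sE] := act_perm pP.
apply: (@code_unimod_equiv R _ _ _ s) => //; first exact: code_vertices_half_integral.
move=> v; have [c sc <-] := rowb_surj v.
by rewrite -sE CG // code_vertices_code.
Qed.

(** Equivalent simplices have codes that differ by a permutation, and the
    invariant does not see permutations. *)
Lemma unimod_equiv_code_inv G G' : G \in codes -> G' \in codes ->
  unimod_equiv (code_simplex R G) (code_simplex R G') ->
  code_inv (in_code G') = code_inv (in_code G).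
Proof.
move=> Gc Gc' /(unimod_equiv_code (code_vertices_unit Gc) (code_vertices_unit Gc'))[s sE].
have [p pP pE] := perm_act s; apply: (code_inv_act pP) => c sc.
by rewrite -!code_vertices_code ?(size_act pP) // pE sE.
Qed.

End Main.

Theorem theorem1p3 (R : realType) :
  ((@unimod_class R 7 @`
     [set P : set 'rV[R]_7 |
        [/\ gorenstein_simplex P, has_dim P 7, degree P = 4
          & ~ lattice_pyramid P]]) #= `I_19)%card.
Proof.
pose P k := code_simplex R (nth [::] codes k).
have codesP k : (k < 19)%N -> nth [::] codes k \in codes by move=> k19; apply: mem_nth.
rewrite (_ : image _ _ = (@unimod_class R 7 \o P) @` `I_19).
  apply: inj_card_eq => k l /set_mem/= k19 /set_mem/= l19 /eq_unimod_class.
  move=> /(unimod_equiv_code_inv (codesP _ k19) (codesP _ l19)) /esym/eqP.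
  have kl := nth_uniq (code_inv (fun=> true)) _ _ codes_inv_uniq.
  rewrite -!(nth_map _ (code_inv (fun=> true)) (fun G => code_inv (in_code G))) //.
  by rewrite kl ?size_map // => /eqP.
apply/seteqP; split=> C.
  case=> Q /gorenstein_degree4_code[G Gc QG] <-.
  exists (index G codes) => /=; first by rewrite -index_mem in Gc.
  by rewrite /P nth_index //; apply/eq_unimod_class; apply: unimod_equiv_sym.
case=> k /= k19 <-; exists (P k) => //.
by apply: code_simplex_gorenstein_degree4; exact: codesP.
Qed.
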